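(* Let $f\in L^2(\Omega)$ and let $u\in H^2_0(\Omega)$ satisfy $a(u,v)=\int_\Omega fv\,dx$ for all $v\in H^2_0(\Omega)$. Let $\mathcal D=(X_{\mathcal D,0},\Pi_{\mathcal D},\nabla_{\mathcal D},\mathcal H^B_{\mathcal D})$ be a $B$-Hessian discretisation and let $u_{\mathcal D}\in X_{\mathcal D,0}$ be the solution of the Hessian scheme: $a_{\mathcal D}(u_{\mathcal D},v_{\mathcal D})=\int_\Omega f\,\Pi_{\mathcal D}v_{\mathcal D}\,dx$ for all $v_{\mathcal D}\in X_{\mathcal D,0}$. Assume that there exists a companion operator, that is, a linear map $E_{\mathcal D}:X_{\mathcal D,0}\to H^2_0(\Omega)$, let $\mathcal P_{\mathcal D}:H^2_0(\Omega)\to X_{\mathcal D,0}$ be a mapping, and define $$q=\frac{-\Delta E_{\mathcal D}(u_{\mathcal D}-\mathcal P_{\mathcal D}u)}{\|\nabla E_{\mathcal D}(u_{\mathcal D}-\mathcal P_{\mathcal D}u)\|}\in H^{-1}(\Omega).$$ Let $\varphi_q\in H^2_0(\Omega)$ be the solution of $a(w,\varphi_q)=(q,w)$ for all $w\in H^2_0(\Omega)$, and assume that $\varphi_q\in H^3(\Omega)\cap H^2_0(\Omega)$. Then $$\begin{aligned}\|\nabla_{\mathcal D}u_{\mathcal D}-\nabla u\|\lesssim{}&\big(\omega(E_{\mathcal D})+\widetilde W^B_{\mathcal D}(\mathcal H\varphi_q)\big)\big(\mathrm{WS}^B_{\mathcal D}(u)+\|\mathcal H^Bu-\mathcal H^B_{\mathcal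 D}\mathcal P_{\mathcal D}u\|\big)+\|\nabla u-\nabla_{\mathcal D}\mathcal P_{\mathcal D}u\|\\&+|\widetilde{\mathcal W}^B_{\mathcal D}(\mathcal H\varphi_q,\mathcal P_{\mathcal D}u)|+\mathrm{WS}^B_{\mathcal D}(u)\,\|\mathcal H^B\varphi_q-\mathcal H^B_{\mathcal D}\mathcal P_{\mathcal D}\varphi_q\|+|\mathcal W^B_{\mathcal D}(\mathcal Hu,\mathcal P_{\mathcal D}\varphi_q)|,\end{aligned}$$ where $X\lesssim Y$ means $X\le CY$ for some $C$ depending only on $\Omega$ and an upper bound of $C^B_{\mathcal D}$.
   Context: Setting. $\Omega\subset\mathbb R^d$ ($d\ge1$) is a bounded domain; $\mathcal S_d(\mathbb R)$ is the space of symmetric $d\times d$ matrices, $\xi:\phi=\sum_{i,j}\xi_{ij}\phi_{ij}$. A fourth order tensor $P=(p_{ijkl})$ acts by $(P\xi)_{ij}=\sum_{k,l}p_{ijkl}\xi_{kl}$, and $P^\tau=(p_{klij})$. $A=(a_{ijkl})$ has measurable bounded coefficients with $a_{ijkl}=a_{jikl}=a_{ijlk}=a_{klij}$, and $B$ is a fourth order tensor, constant over $\Omega$, such that $A\xi:\phi=B\xi:B\phi$ for all $\xi,\phi\in\mathcal S_d(\mathbb R)$, so $A=B^\tau B$. $\mathcal H$ is the Hessian, $\mathcal H^Bv=B\mathcal Hv$, and $\mathcal H:\xi=\sum_{i,j}\partial_{ij}\xi_{ij}$ for matrix-valued $\xi$; $\mathrm{div}$ of a matrix field is taken row-wise. $\|\cdot\|$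 is the $L^2(\Omega)$ norm (scalar, vector or matrix valued); $(\cdot,\cdot)$ is the $L^2$ inner product or the duality pairing between $H^{-1}(\Omega)$ and $H^1_0(\Omega)$. Assume there is $\varrho>0$ with $\|\mathcal H^Bv\|\ge\varrho\|v\|_{H^2(\Omega)}$ for all $v\in H^2_0(\Omega)$. Set $a(u,v)=\int_\Omega\mathcal H^Bu:\mathcal H^Bv\,dx$. A $B$-Hessian discretisation is a quadruplet $\mathcal D=(X_{\mathcal D,0},\Pi_{\mathcal D},\nabla_{\mathcal D},\mathcal H^B_{\mathcal D})$ where $X_{\mathcal D,0}$ is a finite-dimensional real vector space and $\Pi_{\mathcal D}:X_{\mathcal D,0}\to L^2(\Omega)$, $\nabla_{\mathcal D}:X_{\mathcal D,0}\to L^2(\Omega)^d$, $\mathcal H^B_{\mathcal D}:X_{\mathcal D,0}\to L^2(\Omega;\mathbb R^{d\times d})$ are linear, with $\|\mathcal H^B_{\mathcal D}\cdot\|$ a norm on $X_{\mathcal D,0}$. Set $a_{\mathcal D}(u_{\mathcal D},v_{\mathcal D})=\int_\Omega\mathcal H^B_{\mathcal D}u_{\mathcal D}:\mathcal H^B_{\mathcal D}v_{\mathcal D}\,dx$. Accuracy measures: $C^B_{\mathcal D}=\max_{w\in X_{\mathcal D,0}\setminus\{0\}}\max\left(\frac{\|\Pi_{\mathcal D}w\|}{\|\mathcal H^B_{\mathcal D}w\|},\frac{\|\nabla_{\mathcal D}w\|}{\|\mathcal H^B_{\mathcal D}w\|}\right)$; for $\varphi\in H^2_0(\Omega)$, $S^B_{\mathcal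 D}(\varphi)=\min_{w\in X_{\mathcal D,0}}(\|\Pi_{\mathcal D}w-\varphi\|+\|\nabla_{\mathcal D}w-\nabla\varphi\|+\|\mathcal H^B_{\mathcal D}w-\mathcal H^B\varphi\|)$; for $\xi\in H^B(\Omega)=\{\xi\in L^2(\Omega)^{d\times d}:\mathcal H:B^\tau B\xi\in L^2(\Omega)\}$ and $w\in X_{\mathcal D,0}$, $\mathcal W^B_{\mathcal D}(\xi,w)=\int_\Omega\big((\mathcal H:B^\tau B\xi)\Pi_{\mathcal D}w-B\xi:\mathcal H^B_{\mathcal D}w\big)dx$ and $W^B_{\mathcal D}(\xi)=\max_{w\in X_{\mathcal D,0}\setminus\{0\}}\frac{|\mathcal W^B_{\mathcal D}(\xi,w)|}{\|\mathcal H^B_{\mathcal D}w\|}$; $\mathrm{WS}^B_{\mathcal D}(u)=W^B_{\mathcal D}(\mathcal Hu)+S^B_{\mathcal D}(u)$; for $\chi\in L^2(\Omega)^{d\times d}$ with $\mathrm{div}(B^\tau B\chi)\in L^2(\Omega)^d$ and $w\in X_{\mathcal D,0}$, $\widetilde{\mathcal W}^B_{\mathcal D}(\chi,w)=\int_\Omega\big(B\chi:\mathcal H^B_{\mathcal D}w+\mathrm{div}(B^\tau B\chi)\cdot\nabla_{\mathcal D}w\big)dx$ and $\widetilde W^B_{\mathcal D}(\chi)=\max_{w\in X_{\mathcal D,0}\setminus\{0\}}\frac{|\widetilde{\mathcal W}^B_{\mathcal D}(\chi,w)|}{\|\mathcal H^B_{\mathcal D}w\|}$. For the companion operator, $\omega(E_{\mathcal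 D})=\sup_{\psi\in X_{\mathcal D,0}\setminus\{0\}}\frac{\|\nabla_{\mathcal D}\psi-\nabla E_{\mathcal D}\psi\|}{\|\mathcal H^B_{\mathcal D}\psi\|}$.
   Formalization: The constant C may depend, besides Ω and an upper bound of C_D^B, also on B and on an upper bound of ‖φ_q‖ in H³(Ω); with C depending on Ω and C_D^B alone the estimate fails on some domains, since div(B^τBHφ_q) need not be uniformly bounded. *)

(* Defs.v *)
From HB Require Import structures.
From mathcomp Require Import all_boot all_order all_algebra.
From mathcomp Require Import all_classical all_reals all_analysis.

Set Implicit Arguments.
Unset Strict Implicit.
Unset Printing Implicit Defensive.

Import Order.TTheory GRing.Theory Num.Theory.
Import numFieldNormedType.Exports.

Local Open Scope classical_set_scope.
Local Open Scope ring_scope.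

Definition rV_display : measure_display.
Proof. exact. Qed.

Section measurable_rV.
Context {R : realType} (n : nat).

Definition rV_coord (i : 'I_n) (v : 'rV[R]_n) : measurableTypeR R := v ord0 i.

Let rV_set0 : g_sigma_preimage rV_coord set0.
Proof. exact: sigma_algebra0. Qed.

Let rV_setC A : g_sigma_preimage rV_coord A -> g_sigma_preimage rV_coord (~` A).
Proof. exact: sigma_algebraC. Qed.

Let rV_bigcup (F : (set 'rV[R]_n)^nat) :
  (forall i, g_sigma_preimage rV_coord (F i)) ->
  g_sigma_preimage rV_coord (\bigcup_i (F i)).
Proof. exact: sigma_algebra_bigcup. Qed.

HB.instance Definition _ := @isMeasurable.Build rV_display
  'rV[R]_n (g_sigma_preimage rV_coord) rV_set0 rV_setC rV_bigcup.

Lemma measurable_rV_coord (i : 'I_n) : measurable_fun setT (rV_coord i).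
Proof.
move=> _ /= Y mY; rewrite setTI; apply: sub_sigma_algebra.
by rewrite -bigcup_seq; exists i => /=; [exact: mem_index_enum|exists Y; rewrite ?setTI].
Qed.

Lemma measurable_fun_rV d (T : measurableType d) (f : T -> 'rV[R]_n) :
  (forall i, measurable_fun setT (rV_coord i \o f)) -> measurable_fun setT f.
Proof.
move=> mf; apply: (@measurability _ _ _ _ _ _
  (\big[setU/set0]_(i < n) preimage_set_system setT (rV_coord i) measurable)) => //.
move=> B [C + <-]; rewrite -bigcup_seq => -[i _] [A mA <-]; rewrite !setTI.
by have := mf i measurableT A mA; rewrite !setTI.
Qed.

End measurable_rV.

Section lebesgue_step.
Context {R : realType} (n : nat) (mu : {sigma_finite_measure set 'rV[R]_n -> \bar R}).

Definition rV_cons (p : measurableTypeR R * 'rV[R]_n) : 'rV[R]_n.+1 :=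
  row_mx (const_mx p.1 : 'rV_1) p.2.

Definition rV_uncons (v : 'rV[R]_n.+1) : measurableTypeR R * 'rV[R]_n :=
  (v ord0 ord0, rsubmx (v : 'rV_(1 + n))).

Lemma rV_consK : cancel rV_cons rV_uncons.
Proof.
move=> [x v]; congr pair => /=; last exact: row_mxKr.
by rewrite /rV_cons/= mxE; case: splitP => //= j _; rewrite mxE.
Qed.

Lemma measurable_rV_cons : measurable_fun setT rV_cons.
Proof.
apply: measurable_fun_rV => i.
have [j ij|j ij] := splitP (i : 'I_(1 + n)).
  rewrite (_ : _ \o _ = fst); first exact: measurable_fst.
  apply/funext => p; rewrite /= /rV_coord/= /rV_cons mxE.
  by case: splitP => [k _|k]; [rewrite mxE|rewrite ij ord1].
rewrite (_ : _ \o _ = rV_coord j \o snd).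
  by apply: measurableT_comp; [exact: measurable_rV_coord|exact: measurable_snd].
apply/funext => p; rewrite /= /rV_coord/= /rV_cons mxE.
case: splitP => [k|k]; first by rewrite ij ord1.
by rewrite ij => /addnI/val_inj ->.
Qed.

Lemma measurable_rV_uncons : measurable_fun setT rV_uncons.
Proof.
apply/measurable_fun_pairP; split; first exact: measurable_rV_coord.
apply: measurable_fun_rV => i.
rewrite (_ : _ \o _ = @rV_coord R n.+1 (rshift 1 i)).
  exact: measurable_rV_coord.
by apply/funext => v; rewrite /= /rV_coord /= mxE.
Qed.

Definition lebesgue_rV_step : set 'rV[R]_n.+1 -> \bar R :=
  pushforward (lebesgue_measure \x mu)%E rV_cons.

Let step0 : lebesgue_rV_step set0 = 0%E.
Proof. by rewrite /lebesgue_rV_step /pushforward preimage_set0 measure0. Qed.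

Let step_ge0 A : (0 <= lebesgue_rV_step A)%E.
Proof. by rewrite /lebesgue_rV_step /pushforward measure_ge0. Qed.

Let step_sigma_additive : semi_sigma_additive lebesgue_rV_step.
Proof.
exact: (@measure_semi_sigma_additive _ _ _
  (measure_function_pushforward__canonical__measure_function_Measure
    (lebesgue_measure \x mu)%E measurable_rV_cons)).
Qed.

HB.instance Definition _ := isMeasure.Build _ _ _ lebesgue_rV_step
  step0 step_ge0 step_sigma_additive.

Let step_sigma_finite : sigma_finite setT lebesgue_rV_step.
Proof.
have /sigma_finiteP[F [FT ndF Foo]] := sigma_finiteT (@lebesgue_measure R).
have /sigma_finiteP[G [GT ndG Goo]] := sigma_finiteT mu.
exists (fun k => rV_uncons @^-1` (F k `*` G k)).
  rewrite -preimage_bigcup (_ : \bigcup_i (F i `*` G i) = setT) ?preimage_setT//.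
  apply/seteqP; split => // -[x y] _.
  have [i _ Fix] : (\bigcup_i F i) x by rewrite -FT.
  have [j _ Gjy] : (\bigcup_i G i) y by rewrite -GT.
  exists (maxn i j) => //; split => /=.
    by move: x Fix; exact/subsetPset/ndF/leq_maxl.
  by move: y Gjy; exact/subsetPset/ndG/leq_maxr.
move=> k; have [mF Fk] := Foo k; have [mG Gk] := Goo k; split.
  by rewrite -[X in measurable X]setTI; apply: measurable_rV_uncons => //; exact: measurableX.
rewrite /lebesgue_rV_step /pushforward -comp_preimage.
rewrite (_ : rV_uncons \o rV_cons = id); last exact/funext/rV_consK.
by rewrite preimage_id product_measure1E// lte_mul_pinfty// ge0_fin_numE.
Qed.

HB.instance Definition _ := Measure_isSigmaFinite.Build _ _ _ lebesgue_rV_step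
  step_sigma_finite.

End lebesgue_step.

Fixpoint lebesgue_rV (R : realType) (n : nat) :
    {sigma_finite_measure set 'rV[R]_n -> \bar R} :=
  match n with
  | 0 => dirac (0 : 'rV[R]_0)
  | m.+1 => lebesgue_rV_step (lebesgue_rV R m)
  end.

Section test_functions.
Context {R : realType} {d : nat}.
Implicit Types (Omega : set 'rV[R]_d) (f : 'rV[R]_d -> R).

Definition is_domain Omega := [/\ open Omega, connected Omega & Omega !=set0].

Definition basis_vec (i : 'I_d) : 'rV[R]_d := delta_mx ord0 i.

Definition partial (i : 'I_d) f : 'rV[R]_d -> R := fun x => 'D_(basis_vec i) f x.

Definition partials (s : seq 'I_d) f : 'rV[R]_d -> R := foldr partial f s.

(* The classical partial derivatives of every order exist and are continuous. *)
Definition smooth f := forall s : seq 'I_d,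
  continuous (partials s f) /\
  forall i x, derivable (partials s f) x (basis_vec i).

Definition test_fun Omega f :=
  let S := closure [set x | f x != 0] in
  [/\ smooth f, compact S & S `<=` Omega].

End test_functions.

(* Elements of L^2(Omega) and of the Sobolev spaces are represented by        *)
(* functions on the whole space; only their values a.e. on Omega matter.      *)
Section L2.
Context {R : realType} {d : nat}.
Variable Omega : set 'rV[R]_d.
Let mu := lebesgue_rV R d.
Implicit Types (u v g : 'rV[R]_d -> R).

Definition L2 u :=
  measurable_fun Omega u /\ mu.-integrable Omega (EFin \o (fun x => u x ^+ 2)).

Definition L2mx (m n : nat) (xi : 'rV[R]_d -> 'M[R]_(m, n)) :=
  forall i j, L2 (fun x => xi x i j).

Definition ddot (m n : nat) (M N : 'M[R]_(m, n)) : R :=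
  \sum_i \sum_j M i j * N i j.

Definition ip u v : R := \int[mu]_(x in Omega) (u x * v x).

Definition ipmx (m n : nat) (xi phi : 'rV[R]_d -> 'M[R]_(m, n)) : R :=
  \int[mu]_(x in Omega) ddot (xi x) (phi x).

Definition norm2 u : R := Num.sqrt (ip u u).

Definition norm2mx (m n : nat) (xi : 'rV[R]_d -> 'M[R]_(m, n)) : R :=
  Num.sqrt (ipmx xi xi).

End L2.

Section sobolev.
Context {R : realType} {d : nat}.
Variable Omega : set 'rV[R]_d.
Implicit Types (u v g : 'rV[R]_d -> R) (xi : 'rV[R]_d -> 'M[R]_d).

Definition is_weak_partial (i : 'I_d) u g :=
  forall phi, test_fun Omega phi -> ip Omega u (partial i phi) = - ip Omega g phi.

(* The weak operators below choose a representative in L^2(Omega) of the weak *)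
(* derivative; they are meaningful only when one exists (0 otherwise).        *)
Definition weak_partial (i : 'I_d) u : 'rV[R]_d -> R :=
  xget (fun=> 0) [set g | L2 Omega g /\ is_weak_partial i u g].

Fixpoint sobolev (m : nat) u : Prop :=
  L2 Omega u /\
  match m with
  | 0 => True
  | k.+1 => forall i, exists g, is_weak_partial i u g /\ sobolev k g
  end.

Fixpoint sobolev_sqnorm (m : nat) u : R :=
  norm2 Omega u ^+ 2 +
  match m with
  | 0 => 0
  | k.+1 => \sum_(i < d) sobolev_sqnorm k (weak_partial i u)
  end.

Definition sobolev_norm (m : nat) u : R := Num.sqrt (sobolev_sqnorm m u).

(* H^2_0(Omega): the closure of the test functions in H^2(Omega) *)
Definition H20 u :=
  sobolev 2 u /\
  forall e, 0 < e -> exists2 phi, test_fun Omega phi &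
    sobolev_norm 2 (fun x => u x - phi x) < e.

Definition grad u : 'rV[R]_d -> 'rV[R]_d :=
  fun x => \row_i weak_partial i u x.

Definition hess u : 'rV[R]_d -> 'M[R]_d :=
  fun x => \matrix_(i, j) weak_partial j (weak_partial i u) x.

Definition laplacian u : 'rV[R]_d -> R := fun x => \tr (hess u x).

(* H : xi = \sum_(i, j) d_ij xi_ij, integrated by parts twice *)
Definition is_weak_hessdiv xi g :=
  forall phi, test_fun Omega phi ->
    ip Omega g phi =
    ipmx Omega xi (fun x => \matrix_(i, j) partial i (partial j phi) x).

Definition hessdiv xi : 'rV[R]_d -> R :=
  xget (fun=> 0) [set g | L2 Omega g /\ is_weak_hessdiv xi g].

Definition is_weak_rowdiv xi (g : 'rV[R]_d -> 'rV[R]_d) :=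
  forall (i : 'I_d) phi, test_fun Omega phi ->
    ip Omega (fun x => g x ord0 i) phi =
    - ipmx Omega (fun x => row i (xi x)) (fun x => \row_j partial j phi x).

Definition rowdiv xi : 'rV[R]_d -> 'rV[R]_d :=
  xget (fun=> 0) [set g | L2mx Omega g /\ is_weak_rowdiv xi g].

End sobolev.

Section tensors.
Context {R : realType} {d : nat}.

Definition tensor4 := 'I_d -> 'I_d -> 'I_d -> 'I_d -> R.

Definition tapp (P : tensor4) (xi : 'M[R]_d) : 'M[R]_d :=
  \matrix_(i, j) \sum_k \sum_l P i j k l * xi k l.

Definition ttr (P : tensor4) : tensor4 := fun i j k l => P k l i j.

Definition coeff_tensor (Omega : set 'rV[R]_d) (A : 'rV[R]_d -> tensor4) :=
  [/\ forall i j k l, measurable_fun Omega (fun x => A x i j k l),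
      exists M : R, forall x, Omega x -> forall i j k l, `|A x i j k l| <= M
    & forall x, Omega x -> forall i j k l,
        [/\ A x i j k l = A x j i k l, A x i j k l = A x i j l k
          & A x i j k l = A x k l i j]].

Definition factorizes (Omega : set 'rV[R]_d) (A : 'rV[R]_d -> tensor4)
    (B : tensor4) :=
  forall x, Omega x -> forall xi phi : 'M[R]_d, xi^T = xi -> phi^T = phi ->
    ddot (tapp (A x) xi) phi = ddot (tapp B xi) (tapp B phi).

Definition hessB (Omega : set 'rV[R]_d) (B : tensor4) (v : 'rV[R]_d -> R) :
  'rV[R]_d -> 'M[R]_d := fun x => tapp B (hess Omega v x).

Definition aform (Omega : set 'rV[R]_d) (B : tensor4) (u v : 'rV[R]_d -> R) : R :=
  ipmx Omega (hessB Omega B u) (hessB Omega B v).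

Definition coercive (Omega : set 'rV[R]_d) (B : tensor4) :=
  exists2 rho : R, 0 < rho & forall v, H20 Omega v ->
    rho * sobolev_norm Omega 2 v <= norm2mx Omega (hessB Omega B v).

End tensors.
Arguments tensor4 : clear implicits.

Section discretisation.
Context {R : realType} {d : nat}.

Definition ae_linear (Omega : set 'rV[R]_d) (X V : lmodType R)
    (L : X -> 'rV[R]_d -> V) :=
  forall (c : R) (v w : X), ae_eq (lebesgue_rV R d) Omega
    (L (c *: v + w)) (fun x => c *: L v x + L w x).

Definition is_norm (X : lmodType R) (N : X -> R) :=
  [/\ forall w, N w = 0 -> w = 0,
      forall (c : R) w, N (c *: w) = `|c| * N w
    & forall v w, N (v + w) <= N v + N w].

Record hessian_disc (Omega : set 'rV[R]_d) := HessianDisc {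
  XD : vectType R;
  PiD : XD -> 'rV[R]_d -> R;
  gradD : XD -> 'rV[R]_d -> 'rV[R]_d;
  hessD : XD -> 'rV[R]_d -> 'M[R]_d;
  PiD_L2 : forall w, L2 Omega (PiD w);
  gradD_L2 : forall w, L2mx Omega (gradD w);
  hessD_L2 : forall w, L2mx Omega (hessD w);
  PiD_linear : ae_linear (V := R^o) Omega PiD;
  gradD_linear : ae_linear Omega gradD;
  hessD_linear : ae_linear Omega hessD;
  hessD_norm : is_norm (fun w => norm2mx Omega (hessD w)) }.

Variables (Omega : set 'rV[R]_d) (B : tensor4 R d) (D : hessian_disc Omega).

Definition aformD (v w : XD D) : R := ipmx Omega (hessD v) (hessD w).

(* Over the finite-dimensional space XD D all the suprema below are finite;   *)
(* the supremum of the empty set, when XD D is trivial, is 0.                 *)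
Definition CD : R :=
  sup [set r | exists2 w : XD D, w != 0 &
    r = Num.max (norm2 Omega (PiD w) / norm2mx Omega (hessD w))
                (norm2mx Omega (gradD w) / norm2mx Omega (hessD w))].

Definition SD (phi : 'rV[R]_d -> R) : R :=
  inf [set r | exists w : XD D,
    r = norm2 Omega (fun x => PiD w x - phi x) +
        norm2mx Omega (fun x => gradD w x - grad Omega phi x) +
        norm2mx Omega (fun x => hessD w x - hessB Omega B phi x)].

Definition calWD (xi : 'rV[R]_d -> 'M[R]_d) (w : XD D) : R :=
  \int[lebesgue_rV R d]_(x in Omega)
    (hessdiv Omega (fun y => tapp (ttr B) (tapp B (xi y))) x * PiD w x -
     ddot (tapp B (xi x)) (hessD w x)).

Definition WD (xi : 'rV[R]_d -> 'M[R]_d) : R :=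
  sup [set r | exists2 w : XD D, w != 0 &
    r = `|calWD xi w| / norm2mx Omega (hessD w)].

Definition WSD (u : 'rV[R]_d -> R) : R := WD (hess Omega u) + SD u.

Definition calWtD (chi : 'rV[R]_d -> 'M[R]_d) (w : XD D) : R :=
  \int[lebesgue_rV R d]_(x in Omega)
    (ddot (tapp B (chi x)) (hessD w x) +
     ddot (rowdiv Omega (fun y => tapp (ttr B) (tapp B (chi y))) x) (gradD w x)).

Definition WtD (chi : 'rV[R]_d -> 'M[R]_d) : R :=
  sup [set r | exists2 w : XD D, w != 0 &
    r = `|calWtD chi w| / norm2mx Omega (hessD w)].

Definition companion (E : XD D -> 'rV[R]_d -> R) :=
  (forall w, H20 Omega (E w)) /\ ae_linear (V := R^o) Omega E.

Definition omegaD (E : XD D -> 'rV[R]_d -> R) : R :=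
  sup [set r | exists2 w : XD D, w != 0 &
    r = norm2mx Omega (fun x => gradD w x - grad Omega (E w) x) /
        norm2mx Omega (hessD w)].

(* a mapping from H^2_0(Omega), i.e. compatible with a.e. equality *)
Definition H20_map (P : ('rV[R]_d -> R) -> XD D) :=
  forall v w, H20 Omega v -> H20 Omega w ->
    ae_eq (lebesgue_rV R d) Omega v w -> P v = P w.

End discretisation.

(* Main.v *)
Require Import Defs.
From HB Require Import structures.
From mathcomp Require Import all_boot all_order all_algebra.
From mathcomp Require Import all_classical all_reals all_analysis.
From mathcomp Require Import measurable_realfun ring lra.
Import Order.TTheory GRing.Theory Num.Theory.
Import numFieldNormedType.Exports.
Local Open Scope classical_set_scope.
Local Open Scope ring_scope.

(** The proof is an Aubin-Nitsche argument in which Galerkin orthogonality is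
replaced by defects of conformity.

Write [psi = uD - P u] and [e = E psi]. By the triangle inequality the gradient
error is at most the sum of the consistency error of [E] at [psi], of the norm
of [grad e], and of the interpolation error of [u]. Only [grad e] needs an idea:
one integration by parts in H^2_0 ([green_laplacian]) shows that its norm is the
pairing of [q] with [e], so the dual problem makes it the energy pairing of
[phiq] with [e] ([norm_grad_dual]). As [phiq] lies in H^3, another integration
by parts replaces that pairing by minus the integral of [g] against [grad e],
where [g] is the row divergence of the flux of [phiq] ([green_rowdiv]). Adding
and subtracting the discrete gradient and Hessian of [psi], and then the exact
and discrete solutions, gives an exact identity ([duality_identity]) whose terms
are those of the theorem. They are bounded by Cauchy-Schwarz, by the norm of [g]
(controlled by the H^3 norm of [phiq], see [rowdiv_spec]), and by the energy
error estimate [hessian_error], which follows from the observation that the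
defect of [hess u] is the residual of the discrete solution
([calWD_residual]).

Two foundations are built first. The weak operators are defined by choosing a
function among those with prescribed pairings against test functions, so
everything rests on the fundamental lemma of the calculus of variations
([ae_eq_of_test]); it is obtained by approximating indicators of boxes by
products of one-dimensional bumps and applying the pi-lambda theorem. It also
requires integration by parts for test functions, which reduces to the vanishing
of the integral of a partial derivative ([integral_partial0]), by Fubini.
Secondly, the suprema [omegaD] and [WtD] are bounds only if they are finite;
this comes from the domination of seminorms by norms on a finite-dimensional
space ([finite_dim_seminorm_le]). *)

Set Implicit Arguments.
Unset Strict Implicit.
Unset Printing Implicit Defensive.

(** * Boxes and Borel sets *)

Section boxes.
Context {R : realType} {n : nat}.
Implicit Types a b x : 'rV[R]_n.

Definition obox a b : set 'rV[R]_n :=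
  [set x | forall i, a ord0 i < x ord0 i < b ord0 i].

Definition cbox a b : set 'rV[R]_n :=
  [set x | forall i, a ord0 i <= x ord0 i <= b ord0 i].

Lemma sub_obox_cbox a b : obox a b `<=` cbox a b.
Proof. by move=> x abx i; have /andP[/ltW -> /ltW ->] := abx i. Qed.

Lemma obox_setI a b a' b' :
  obox a b `&` obox a' b' =
  obox (\row_i Num.max (a ord0 i) (a' ord0 i))
       (\row_i Num.min (b ord0 i) (b' ord0 i)).
Proof.
apply/seteqP; split => x /=.
  move=> [h h'] i; have /andP[h1 h2] := h i; have /andP[h3 h4] := h' i.
  by rewrite !mxE gt_max lt_min h1 h2 h3 h4.
move=> h; split => i; have := h i; rewrite !mxE gt_max lt_min;
  by move=> /andP[/andP[h1 h2] /andP[h3 h4]]; apply/andP.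
Qed.

Lemma compact_cbox a b : compact (cbox a b).
Proof.
rewrite (_ : cbox a b = [set v | forall i,
    `[a ord0 i, b ord0 i]%classic (v ord0 i)]); last first.
  by apply/seteqP; split => x h i; have := h i; rewrite /= in_itv.
by apply: (@rV_compact _ _ (fun i => `[a ord0 i, b ord0 i]%classic)) => i;
    exact: segment_compact.
Qed.

Lemma measurable_bigcap_ord (F : 'I_n -> set 'rV[R]_n) :
  (forall i, measurable (F i)) -> measurable [set x | forall i, F i x].
Proof.
move=> mF; rewrite (_ : mkset _ = \big[setI/setT]_(i < n) F i).
  by apply: bigsetI_measurable => i _; exact: mF.
rewrite -bigcap_seq; apply/seteqP; split => x /= h i.
  by move=> _; exact: h.
by apply: h => /=; rewrite mem_index_enum.
Qed.

Lemma measurable_coord_preimage (i : 'I_n) (A : set R) :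
  measurable A -> measurable [set x : 'rV[R]_n | A (x ord0 i)].
Proof.
move=> mA; have := measurable_rV_coord i measurableT mA.
by rewrite setTI.
Qed.

Lemma measurable_obox a b : measurable (obox a b).
Proof.
rewrite (_ : obox a b = [set x | forall i,
    [set y : 'rV[R]_n | `]a ord0 i, b ord0 i[%classic (y ord0 i)] x]).
  by apply: measurable_bigcap_ord => i; exact: measurable_coord_preimage.
by apply/seteqP; split => x h i; have := h i; rewrite /= in_itv.
Qed.

Lemma measurable_cbox a b : measurable (cbox a b).
Proof.
rewrite (_ : cbox a b = [set x | forall i,
    [set y : 'rV[R]_n | `[a ord0 i, b ord0 i]%classic (y ord0 i)] x]).
  by apply: measurable_bigcap_ord => i; exact: measurable_coord_preimage.
by apply/seteqP; split => x h i; have := h i; rewrite /= in_itv.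
Qed.

Definition ratbox (p : 'rV[rat]_n) : 'rV[R]_n := map_mx ratr p.

(** Openness for the sup norm: each coordinate is enclosed separately by two
rationals at distance less than the radius of a ball. *)
Lemma rational_box_nbhs (U : set 'rV[R]_n) x : open U -> U x ->
  exists p q, obox (ratbox p) (ratbox q) x /\
              cbox (ratbox p) (ratbox q) `<=` U.
Proof.
move=> oU Ux; have /nbhs_ballP[e e0 eU] : nbhs x U by exact: open_nbhs_nbhs.
have [p px] : exists p : 'I_n -> rat, forall i,
    x ord0 i - e < ratr (p i) < x ord0 i.
  apply: (@fin_all_exists _ (fun=> rat) (fun i p => x ord0 i - e < ratr p < x
      ord0 i)) => i.
  have [|r] := @rat_in_itvoo R (x ord0 i - e) (x ord0 i); first by rewrite gtrBl.
  by rewrite in_itv /= => ?; exists r.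
have [q qx] : exists q : 'I_n -> rat, forall i,
    x ord0 i < ratr (q i) < x ord0 i + e.
  apply: (@fin_all_exists _ (fun=> rat) (fun i p => x ord0 i < ratr p < x ord0
      i + e)) => i.
  have [|r] := @rat_in_itvoo R (x ord0 i) (x ord0 i + e); first by rewrite ltrDl.
  by rewrite in_itv /= => ?; exists r.
exists (\row_i p i), (\row_i q i); split.
  by move=> i; rewrite !mxE; have /andP[_ ->] := px i; have /andP[-> _] := qx i.
move=> y /= yb; apply: eU; split => // i j; rewrite (ord1 i) /ball /= ltr_distlC.
have := yb j; rewrite !mxE => /andP[h1 h2].
have /andP[h3 _] := px j; have /andP[_ h4] := qx j.
by rewrite (lt_le_trans h3 h1) (le_lt_trans h2 h4).
Qed.

(** The union is countable, which makes open sets measurable for the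
sigma-algebra generated by the coordinates. *)
Lemma open_bigcup_box (U : set 'rV[R]_n) : open U ->
  U = \bigcup_(pq in [set pq : 'rV[rat]_n * 'rV[rat]_n |
         cbox (ratbox pq.1) (ratbox pq.2) `<=` U])
        obox (ratbox pq.1) (ratbox pq.2).
Proof.
move=> oU; apply/seteqP; split.
  move=> x /(rational_box_nbhs oU)[p [q [xpq pqU]]].
  by exists (p, q).
by move=> x [[p q] /= pqU /sub_obox_cbox]; exact: pqU.
Qed.

Lemma open_measurable_rV (U : set 'rV[R]_n) : open U -> measurable U.
Proof.
move=> oU; rewrite (open_bigcup_box oU).
rewrite bigcup_mkcond; apply: countable_bigcupT_measurable => [|pq]; first
    exact: countableP.
by case: ifP => _ //; exact: measurable_obox.
Qed.
End boxes.

Section borel.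
Context {R : realType} {n : nat}.
Implicit Types a b x : 'rV[R]_n.

Lemma continuous_measurable_rV (f : 'rV[R]_n -> R) :
  continuous f -> measurable_fun setT f.
Proof.
move=> /continuousP cf; apply: (measurability _ (RGenOpens.measurableE R)).
move=> _ [_ [a [b ->]] <-]; rewrite setTI.
by apply: open_measurable_rV; apply: cf; exact: itv_open.
Qed.

Lemma normr_coord_le x i : `|x ord0 i| <= `|x|.
Proof.
by rewrite [leRHS]/Num.norm /= mx_normrE; apply/bigmax_geP; right => /=; exists
    (ord0, i).
Qed.

Lemma rV_in_obox x : exists k : nat,
  obox (const_mx (- k%:R)) (const_mx k%:R) x.
Proof.
exists (Num.truncn `|x|).+1 => i; rewrite !mxE -ltr_norml.
by rewrite (le_lt_trans (normr_coord_le x i))// truncnS_gt.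
Qed.

Definition oboxes : set (set 'rV[R]_n) :=
  [set A | exists a b, A = obox a b].

(** Open boxes are stable under intersection ([obox_setI]); as they generate the
sigma-algebra, the pi-lambda theorem applies to them. *)
Lemma measurable_generated_oboxes : measurable = <<s oboxes >>.
Proof.
apply/seteqP; split.
  apply: smallest_sub; first exact: smallest_sigma_algebra.
  move=> X; rewrite -bigcup_seq => -[i _] [B mB <-].
  have mi : measurable_fun setT
      (rV_coord i : g_sigma_algebraType oboxes -> measurableTypeR R).
    apply: (measurability _ (RGenOpens.measurableE R)) => _ [_ [s [t ->]] <-].
    rewrite setTI (_ : _ @^-1` _ = \bigcup_(k : nat) obox
      (\row_j if j == i then s else - k%:R)
      (\row_j if j == i then t else k%:R)).
      by apply: bigcupT_measurable => k; apply: sub_sigma_algebra; do 2 eexists.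
    apply/seteqP; split => x /=.
      rewrite in_itv /= => sxt; have [k kx] := rV_in_obox x.
      exists k => // j; rewrite !mxE; case: eqP => [->//|_].
      by have := kx j; rewrite !mxE.
    by move=> [k _ /(_ i)]; rewrite !mxE eqxx in_itv.
  exact: mi.
apply: smallest_sub; first exact: sigma_algebra_measurable.
by move=> _ [a [b ->]]; exact: measurable_obox.
Qed.

End borel.

(** * Slices and the mean value of a partial derivative *)

Section cons.
Context {R : realType} {n : nat}.
Implicit Types (x : R) (y : 'rV[R]_n).

Lemma rV_cons_head x y : rV_cons (x, y) ord0 ord0 = x.
Proof. by rewrite /rV_cons mxE; case: splitP => //= j _; rewrite mxE. Qed.

Lemma rV_cons_tail x y (i : 'I_n) : rV_cons (x, y) ord0 (lift ord0 i) = y ord0 i.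
Proof.
rewrite /rV_cons mxE; case: splitP => j /=; first by case: j => -[].
by rewrite /bump /= add1n => -[] ij; congr (y _ _); exact/val_inj.
Qed.

Definition rV_tail (a : 'rV[R]_n.+1) : 'rV[R]_n := \row_i a ord0 (lift ord0 i).

Lemma rV_cons_cbox (a b : 'rV[R]_n.+1) :
  @rV_cons R n @^-1` cbox a b = `[a ord0 ord0, b ord0 ord0]%classic `*`
    cbox (rV_tail a) (rV_tail b).
Proof.
apply/seteqP; split => -[x y] /=.
  move=> h; split; first by have := h ord0; rewrite in_itv /= rV_cons_head.
  by move=> i; have := h (lift ord0 i); rewrite rV_cons_tail !mxE.
rewrite in_itv /= => -[h1 h2] i; case: (unliftP ord0 i) => [j|] ->.
  by have := h2 j; rewrite rV_cons_tail !mxE.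
by rewrite rV_cons_head.
Qed.

End cons.

Lemma lebesgue_rV_cbox (R : realType) n (a b : 'rV[R]_n) :
  (lebesgue_rV R n (cbox a b) < +oo)%E.
Proof.
elim: n a b => [|n IH] a b; first by rewrite /lebesgue_rV/= diracE ltry.
rewrite /= /lebesgue_rV_step /pushforward rV_cons_cbox.
rewrite product_measure1E//; last exact: measurable_cbox.
apply: lte_mul_pinfty => //.
have I : lebesgue_measure (`[a ord0 ord0, b ord0 ord0]%classic : set R)
    \is a fin_num.
  by rewrite lebesgue_measure_itv/=; case: ifP => _; rewrite -?EFinB.
exact: I.
Qed.

(** A directional derivative only sees the restriction of the function to a
line; this transfers derivatives between a function and its slices. *)
Lemma line_derive_eq (R : realType) (V W : normedModType R) (f : V -> R)
    (g : W -> R) x v y w :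
  (forall h : R, f (h *: v + x) = g (h *: w + y)) ->
  (derivable f x v <-> derivable g y w) /\ 'D_v f x = 'D_w g y.
Proof.
move=> fg; have fgE : (fun h : R => h^-1 *: ((f \o shift x) (h *: v) - f x)) =
    (fun h : R => h^-1 *: ((g \o shift y) (h *: w) - g y)).
  apply/funext => h /=; rewrite fg; congr (_ *: (_ - _)).
  by have := fg 0; rewrite !scale0r !add0r.
by split; [rewrite /derivable fgE|rewrite /derive fgE].
Qed.

Section zero_integral.
Context {R : realType}.

Lemma continuous_cons_tail n (x : R) (f : 'rV[R]_n.+1 -> R) :
  continuous f -> continuous (fun y : 'rV[R]_n => f (rV_cons (x, y))).
Proof.
move=> cf y.
apply: (@continuous_comp _ _ _ (fun y => rV_cons (x, y)) f); last exact: cf.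
move=> A /nbhs_ballP[e e0 eA]; apply/nbhs_ballP; exists e => //= z [_ yz];
    apply: eA.
split => // i j; rewrite (ord1 i); case: (unliftP ord0 j) => [k|] ->.
  by rewrite !rV_cons_tail; exact: yz.
by rewrite !rV_cons_head; exact: ballxx.
Qed.

Lemma continuous_cons_head n (y : 'rV[R]_n) (f : 'rV[R]_n.+1 -> R) :
  continuous f -> continuous (fun x : R => f (rV_cons (x, y))).
Proof.
move=> cf x.
apply: (@continuous_comp _ _ _ (fun x : R => rV_cons (x, y)) f); last exact: cf.
move=> A /nbhs_ballP[e e0 eA]; apply/nbhs_ballP; exists e => //= z xz; apply: eA.
split => // i j; rewrite (ord1 i); case: (unliftP ord0 j) => [k|] ->.
  by rewrite !rV_cons_tail; exact: ballxx.
by rewrite !rV_cons_head.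
Qed.

Lemma rV_cons_shift_head n (h x : R) (y : 'rV[R]_n) :
  h *: basis_vec ord0 + rV_cons (x, y) = rV_cons (h + x, y).
Proof.
apply/rowP => j; rewrite mxE [X in X + _]mxE [X in _ * X]mxE eqxx /=.
case: (unliftP ord0 j) => [k|] ->.
  by rewrite !rV_cons_tail mulr0 add0r.
by rewrite !rV_cons_head mulr1.
Qed.

Lemma rV_cons_shift_tail n (h x : R) (y : 'rV[R]_n) i :
  h *: basis_vec (lift ord0 i) + rV_cons (x, y) = rV_cons (x, h *: basis_vec i + y).
Proof.
apply/rowP => j; rewrite mxE [X in X + _]mxE [X in _ * X]mxE eqxx /=.
case: (unliftP ord0 j) => [k|] ->.
  by rewrite !rV_cons_tail !mxE eqxx /= (inj_eq lift_inj).
by rewrite !rV_cons_head mulr0 add0r.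
Qed.

Definition cube n (M : R) : set 'rV[R]_n := cbox (const_mx (- M)) (const_mx M).

(** The complement of the cube is open, so [F] vanishes near [x]. *)
Lemma partial_out_cube n (M : R) (F : 'rV[R]_n -> R) i x :
  (forall x, ~ cube M x -> F x = 0) -> ~ cube M x -> partial i F x = 0.
Proof.
move=> F0 xM; rewrite /partial.
rewrite (@near_eq_derive _ _ _ F (cst 0)); first exact: derive_cst.
have : nbhs x (~` (cube M : set 'rV[R]_n)).
  apply: open_nbhs_nbhs; split => //; rewrite openC.
  by apply: compact_closed; [exact: norm_hausdorff|exact: compact_cbox].
by apply: filterS => y /F0.
Qed.

Lemma bounded_out_cube n (M : R) (F : 'rV[R]_n -> R) : continuous F ->
  (forall x, ~ cube M x -> F x = 0) -> exists C, forall x, `|F x| <= C.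
Proof.
move=> cF F0.
have : bounded_set (F @` (cube M : set 'rV[R]_n)).
  apply/compact_bounded/continuous_compact; last exact: compact_cbox.
  exact: continuous_subspaceT.
move=> [C [_ hC]]; exists (`|C| + 1) => x.
have C1 : C < `|C| + 1 by rewrite (le_lt_trans (ler_norm _))// ltrDl.
have [xM|xM] := pselect ((cube M : set 'rV[R]_n) x).
  by apply: (hC _ C1); exists x.
by rewrite F0// normr0 addr_ge0.
Qed.

Lemma bounded_integrable d (T : measurableType d) (m : {measure set T -> \bar R})
    (A : set T) (f : T -> R) (C : R) :
  measurable A -> (m A < +oo)%E -> measurable_fun setT f ->
  (forall x, `|f x| <= C) -> (forall x, ~ A x -> f x = 0) ->
  m.-integrable setT (EFin \o f).
Proof.
move=> mA mAoo mf fC f0.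
have -> : EFin \o f = (EFin \o f) \_ A.
  apply/funext => x; rewrite patchE; case: ifPn => // /negP xA /=.
  by rewrite f0// => ?; apply: xA; rewrite inE.
apply/(integrable_mkcond _ mA)/measurable_bounded_integrable => //.
  exact: measurable_funTS.
exists C; split; first exact: num_real.
by move=> K CK x _; exact: le_trans (fC x) (ltW CK).
Qed.

(** The fundamental theorem of calculus on an interval larger than the support;
both boundary values vanish. *)
Lemma integral_deriv_zero (M : R) (f f' : R -> R) :
  (forall x : R, is_derive x 1 f (f' x)) -> continuous f' ->
  (forall x : R, M < `|x| -> f x = 0) ->
  (\int[lebesgue_measure]_x (f' x)%:E = 0)%E.
Proof.
move=> ff' cf' f0.
pose K := `|M| + 1; have K0 : 0 < K by rewrite /K ltr_wpDl.
have MK : M < K by rewrite /K (le_lt_trans (ler_norm _))// ltrDl.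
have f'0 x : K < `|x| -> f' x = 0.
  move=> Kx; have -> : f' x = 'D_1 f x by case: (ff' x) => _ ->.
  rewrite (@near_eq_derive _ _ _ f (cst 0)); first exact: derive_cst.
  have : nbhs x [set y : R | K < `|y|].
    apply: open_nbhs_nbhs; split => //.
    have := @open_comp _ _ (fun y : R => `|y|) `]K, +oo[%classic.
    have -> : (fun y : R => `|y|) @^-1` `]K, +oo[%classic = [set y | K < `|y|].
      by apply/seteqP; split => y /=; rewrite in_itv /= andbT.
    by apply => [y _|]; [exact: norm_continuous|exact: rray_open].
  by apply: filterS => y /= /(lt_trans MK)/f0.
rewrite [LHS](_ : _ = \int[lebesgue_measure]_(x in `[(- (K + 1))%R, (K + 1)%R])
    (f' x)%:E)%E; last first.
  rewrite [RHS]integral_mkcond; apply: eq_integral => x _.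
  rewrite patchE; case: ifPn => //; rewrite notin_setE /= in_itv /= => /negP.
  rewrite -ler_norml -ltNge => h; rewrite f'0//.
  by rewrite (lt_trans _ h)// ltrDl.
rewrite (@continuous_FTC2 _ f' f).
- by rewrite !f0 ?subee// ?normrN ger0_norm ?addr_ge0// ?ltW// (lt_trans MK)//
    ltrDl.
- by rewrite -subr_gt0 opprK addr_gt0// addr_gt0.
- exact: continuous_subspaceT.
- have cf : continuous f.
    by move=> x; apply/differentiable_continuous/derivable1_diffP; case: (ff' x).
  split; [by move=> x _; case: (ff' x)| |].
    by apply: cvg_at_right_filter; exact: cf.
  by apply: cvg_at_left_filter; exact: cf.
- by move=> x _; rewrite derive1E; case: (ff' x).
Qed.

(** Induction on the dimension, along the recursive definition of the measure.
Fubini separates the first coordinate: if it is the direction of derivation the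
inner integral vanishes by the one-dimensional case, otherwise the induction
hypothesis applies to the slices. *)
Lemma integral_partial0 n (i : 'I_n) (M : R) (F : 'rV[R]_n -> R) :
  (forall x, derivable F x (basis_vec i)) -> continuous F ->
  continuous (partial i F) ->
  (forall x, ~ cube M x -> F x = 0) ->
  (\int[lebesgue_rV R n]_x (partial i F x)%:E = 0)%E.
Proof.
elim: n i F => [[]//|n IH] i F dF cF cdF F0.
pose G := partial i F.
have G0 x : ~ cube M x -> G x = 0 by exact: partial_out_cube.
have [C hC] := bounded_out_cube cdF G0.
have mG : measurable_fun setT (EFin \o G).
  apply/measurable_EFinP; exact: continuous_measurable_rV.
have iG : (lebesgue_measure \x lebesgue_rV R n)%E.-integrable setT
    ((EFin \o G) \o @rV_cons R n).
  apply: (@bounded_integrable _ _ _ (@rV_cons R n @^-1` cube M) (G \o @rV_cons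
      R n) C).
  - rewrite rV_cons_cbox; apply: measurableX => //; exact: measurable_cbox.
  - have := lebesgue_rV_cbox (const_mx (- M) : 'rV[R]_n.+1) (const_mx M); exact.
  - apply: measurableT_comp; last exact: measurable_rV_cons.
    exact: continuous_measurable_rV.
  - by move=> x; exact: hC.
  - by move=> x xM; rewrite /= G0.
transitivity (\int[pushforward (lebesgue_measure \x lebesgue_rV R n) (@rV_cons
    R n)]_x (EFin \o G) x)%E.
  by [].
rewrite (integral_pushforward (@measurable_rV_cons R n) mG iG measurableT)
    preimage_setT.
case: (unliftP ord0 i) => [j ij|i0].
  rewrite -(integral12_prod_meas1 iG) /=.
  rewrite (eq_integral (cst 0%E)) ?integral_cst ?mul0e// => x _ /=.
  have slice y := @line_derive_eq R 'rV[R]_n.+1 'rV[R]_n F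
    (fun y => F (rV_cons (x, y))) (rV_cons (x, y)) (basis_vec (lift ord0 j))
    y (basis_vec j) (fun h => congr1 F (rV_cons_shift_tail h x y j)).
  have dE y : G (rV_cons (x, y)) = partial j (fun y => F (rV_cons (x, y))) y.
    by rewrite /G /partial ij; case: (slice y).
  rewrite /fubini_F -[RHS](IH j (fun y => F (rV_cons (x, y)))).
  - by apply: eq_integral => y _; rewrite /= dE.
  - by move=> y; have [[+ _] _] := slice y; apply; rewrite -ij.
  - exact: continuous_cons_tail.
  - rewrite (_ : partial j _ = fun y => G (rV_cons (x, y))).
      exact: continuous_cons_tail.
    by apply/funext => y; rewrite dE.
  - move=> y yM; apply: F0 => xyM; apply: yM => k.
    by have := xyM (lift ord0 k); rewrite rV_cons_tail !mxE.
rewrite -(integral21_prod_meas1 iG) /=.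
rewrite (eq_integral (cst 0%E)) ?integral_cst ?mul0e// => y _ /=.
apply: (@integral_deriv_zero M (fun x : R => F (rV_cons (x, y)))
  (fun x : R => G (rV_cons (x, y)))).
- move=> x; have sh h : F (h *: basis_vec ord0 + rV_cons (x, y)) =
      F (rV_cons (h *: (1 : R) + x, y)).
    by rewrite rV_cons_shift_head /GRing.scale /= mulr1.
  have [[d1 _] d2] := @line_derive_eq R 'rV[R]_n.+1 R F
    (fun x : R => F (rV_cons (x, y))) _ _ _ _ sh.
  apply: DeriveDef; first by apply: d1; rewrite -i0.
  by rewrite -d2 /G /partial i0.
- exact: continuous_cons_head.
- move=> x Mx; apply: F0 => /(_ ord0).
  by rewrite rV_cons_head !mxE -ler_norml leNgt Mx.
Qed.

End zero_integral.

(** * Smooth bumps on the line *)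

Section smooth1.
Context {R : realType}.
Implicit Types f g : R -> R.

Fixpoint Ck (k : nat) f : Prop :=
  match k with
  | 0 => continuous f
  | m.+1 => (forall x, derivable f x 1) /\ Ck m (derive1 f)
  end.

Lemma Ck_is_derive k f g : (forall x : R, is_derive x 1 f (g x)) ->
  Ck k g -> Ck k.+1 f.
Proof.
move=> fg kg; split; first by move=> x; case: (fg x).
rewrite (_ : (derive1 f) = g)//; apply/funext => x.
by rewrite derive1E; case: (fg x).
Qed.

Lemma Ck_is_deriveE k f (x : R) : Ck k.+1 f -> is_derive x 1 f ((derive1 f) x).
Proof. by move=> [df _]; apply: DeriveDef; rewrite ?derive1E. Qed.

Lemma Ck_pred k f : Ck k.+1 f -> Ck k f.
Proof.
elim: k f => [|k IH] f [df kf]; last by split => //; exact: IH.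
by move=> x; apply/differentiable_continuous/derivable1_diffP.
Qed.

Lemma Ck_cst k (c : R) : Ck k (cst c).
Proof.
elim: k c => [|k IH] c; first exact: cst_continuous.
by apply: (@Ck_is_derive _ _ (cst 0)) => // x; exact: is_derive_cst.
Qed.

Lemma Ck_lin k (c : R) f g : Ck k f -> Ck k g -> Ck k (fun x => c * f x + g x).
Proof.
elim: k f g => [|k IH] f g.
  move=> cf cg x; apply: cvgD; last exact: cg.
  by apply: cvgM; [exact: cvg_cst|exact: cf].
move=> kf kg; apply: (@Ck_is_derive _ _ (fun x => c * (derive1 f) x + (derive1
    g) x)).
  move=> x; apply: is_deriveD; last exact: Ck_is_deriveE kg.
  by apply: is_deriveZ; exact: Ck_is_deriveE kf.
by apply: IH; [case: kf|case: kg].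
Qed.

Lemma Ck_mul k f g : Ck k f -> Ck k g -> Ck k (fun x => f x * g x).
Proof.
elim: k f g => [|k IH] f g.
  by move=> cf cg x; apply: cvgM; [exact: cf|exact: cg].
move=> kf kg.
apply: (@Ck_is_derive _ _ (fun x => 1 * (f x * (derive1 g) x) + g x * (derive1
    f) x)).
  move=> x; rewrite mul1r; apply: is_deriveM; [exact: Ck_is_deriveE kf|exact:
      Ck_is_deriveE kg].
by apply: Ck_lin; apply: IH; [exact: Ck_pred|case: kg|exact: Ck_pred|case: kf].
Qed.

Lemma Ck_affine k f (c b : R) : Ck k f -> Ck k (fun x => f (c * x + b)).
Proof.
elim: k f => [|k IH] f.
  move=> cf x; apply: continuous_comp; last exact: cf.
  by apply: cvgD; [apply: cvgM => //; exact: cvg_cst|exact: cvg_cst].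
move=> kf; apply: (@Ck_is_derive _ _ (fun x => c * (derive1 f) (c * x + b) +
    cst 0 x)).
  move=> x; rewrite addr0.
  have d1 : is_derive x (1 : R) (fun x : R => c * x + b) c.
    rewrite (_ : (fun _ => _) = (c *: id) + cst b) //.
    by apply: is_derive_eq; rewrite addr0 /GRing.scale /= mulr1.
  have := @is_derive1_comp _ f _ x _ _ (Ck_is_deriveE (c * x + b) kf) d1.
  by rewrite mulrC.
by apply: Ck_lin; [apply: IH; case: kf|exact: Ck_cst].
Qed.

(** Up to linear combinations the family [flat m] is stable under
differentiation; [flat 0] is the standard smooth function that vanishes exactly
on the nonpositive half-line. *)
Definition flat (m : nat) (t : R) : R :=
  if t <= 0 then 0 else t ^- m * expR (- t^-1).

(** The exponential beats every power: [expR s] is at least the term of degree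
[m + 2] of its series, at [s = t^-1]. The quadratic bound makes [flat m] flat at
the origin. *)
Lemma flat_le (m : nat) (t : R) : 0 <= flat m t <= m.+2`!%:R * t ^+ 2.
Proof.
rewrite /flat; case: (leP t 0) => [_|t0].
  by rewrite lexx mulr_ge0// sqr_ge0.
have ti0 : 0 < t^-1 by rewrite invr_gt0.
apply/andP; split; first by rewrite mulr_ge0 ?expR_ge0// invr_ge0 exprn_ge0// ltW.
rewrite expRN -invfM invf_ple ?posrE; last 2 first.
- by rewrite mulr_gt0 ?exprn_gt0 ?expR_gt0.
- by rewrite mulr_gt0 ?exprn_gt0 ?ltr0n ?fact_gt0.
have h : t ^- m.+2 / m.+2`!%:R <= expR t^-1.
  by rewrite -exprVn; apply: le_trans (expR_ge1Dxn m.+1 (ltW ti0)); rewrite lerDr.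
rewrite invfM mulrC -ler_pdivrMl ?exprn_gt0// (le_trans _ h)//.
rewrite mulrA -invfM -exprD addn2//.
Qed.

Lemma flat_is_derive (m : nat) (t : R) :
  is_derive t 1 (flat m) (- m%:R * flat m.+1 t + flat m.+2 t).
Proof.
have [t0|t0|->] := ltgtP t 0.
- rewrite /flat (ltW t0) /= mulr0 addr0.
  apply: (@near_eq_is_derive _ _ _ (cst 0)).
  near=> s; suff /ltW -> : s < 0 by [].
  by near: s; exact: lt_nbhsl.
- have flatE k : flat k t = t ^- k * expR (- t^-1) by rewrite /flat leNgt t0.
  rewrite !flatE.
  apply: (@near_eq_is_derive R R R (fun s : R => s ^- m * expR (- s^-1))).
    near=> s; suff : 0 < s by move=> s0; rewrite /flat leNgt s0.
    by near: s; exact: lt_nbhsr.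
  have t_neq0 : t != 0 by rewrite gt_eqF.
  have dinv : is_derive t (1 : R) (fun s : R => s^-1) (- t ^- 2).
    apply: is_derive_eq; first by apply: (@is_deriveV _ id).
    by rewrite /GRing.scale /= mulr1.
  have dexp : is_derive t (1 : R) (fun s : R => expR (- s^-1)) (expR (- t^-1) *
      t ^- 2).
    apply: (@is_derive1_comp _ expR (fun s : R => - s^-1)).
    rewrite (_ : (fun _ => _) = - (fun s : R => s^-1)) //.
    by apply: is_derive_eq; rewrite opprK.
  have -> : (fun s : R => s ^- m * expR (- s^-1)) =
      ((fun s : R => s^-1) ^+ m) * (fun s : R => expR (- s^-1)).
    by apply/funext => s; rewrite -exprVn; congr (_ * _); elim: m => // m IH;
        rewrite !exprS IH.
  apply: is_derive_eq.
  rewrite /GRing.scale /=.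
  have -> : ((fun s : R => s^-1) ^+ m) t = t^-1 ^+ m.
    by elim: m => // m IH; rewrite !exprS -IH.
  rewrite -!exprVn; set u := t^-1; set E := expR _.
  by case: m => [|m] /=; rewrite ?exprS; ring.
- (* At the origin the difference quotient is at most linear, by [flat_le]. *)
  have flat0 k : flat k 0 = 0 by rewrite /flat lexx.
  rewrite !flat0 mulr0 addr0.
  suff h0 : h^-1 *: (flat m (h *: (1 : R) + 0) - flat m 0) @[h --> (0 : R)^']
      --> (0 : R).
    by apply: DeriveDef; [exact: cvgP h0|exact: cvg_lim h0].
  have Ck0 : 0 < m.+2`!%:R :> R by rewrite ltr0n fact_gt0.
  apply/cvgr0Pnorm_le => e e0; near=> h.
  rewrite flat0 subr0 addr0 /GRing.scale /= mulr1.
  have h_neq0 : h != 0 by near: h; exact: nbhs_dnbhs_neq.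
  have /andP[f0 fh] := flat_le m h.
  rewrite normrM normfV (ger0_norm f0) mulrC ler_pdivrMr ?normr_gt0//.
  apply: (le_trans fh); rewrite -[h ^+ 2]real_normK ?num_real// expr2 mulrA.
  apply: ler_wpM2r => //; rewrite mulrC -ler_pdivlMr//.
  by near: h; apply: dnbhs0_le; exact: divr_gt0.
Unshelve. all: by end_near. Qed.

Lemma Ck_flat k m : Ck k (flat m).
Proof.
elim: k m => [|k IH] m.
  by move=> x; apply/differentiable_continuous/derivable1_diffP; case:
      (flat_is_derive m x).
by apply: Ck_is_derive; [exact: flat_is_derive|exact: Ck_lin].
Qed.

Definition smooth1 f := forall k, Ck k f.

Lemma smooth1_derive1 f : smooth1 f -> smooth1 (derive1 f).
Proof. by move=> sf k; case: (sf k.+1). Qed.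

(** Supported in the closed interval, and tending to the indicator of the open
one as [k] grows, because [flat 0] tends to 1 at infinity. *)
Definition bump (a b : R) (k : nat) (t : R) : R :=
  flat 0 (k.+1%:R * (t - a)) * flat 0 (k.+1%:R * (b - t)).

Lemma smooth1_bump a b k : smooth1 (bump a b k).
Proof.
move=> m; apply: Ck_mul.
  have := Ck_affine (k.+1%:R) (- (k.+1%:R * a)) (Ck_flat m 0).
  by congr Ck; apply/funext => t; rewrite mulrBr.
have := Ck_affine (- k.+1%:R) (k.+1%:R * b) (Ck_flat m 0).
by congr Ck; apply/funext => t; rewrite mulrBr mulNr addrC.
Qed.

Lemma flat0_01 (t : R) : 0 <= flat 0 t <= 1.
Proof.
rewrite /flat; case: (leP t 0) => [_|t0]; first by rewrite lexx ler01.
by rewrite expr0 invr1 mul1r expR_ge0 expR_le1 oppr_le0 invr_ge0 ltW.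
Qed.

Lemma bump_01 a b k t : 0 <= bump a b k t <= 1.
Proof.
have /andP[p0 p1] := flat0_01 (k.+1%:R * (t - a)).
have /andP[q0 q1] := flat0_01 (k.+1%:R * (b - t)).
by rewrite /bump mulr_ge0// mulr_ile1.
Qed.

Lemma bump_out a b k t : ~~ (a < t < b) -> bump a b k t = 0.
Proof.
rewrite negb_and -!leNgt /bump /flat => /orP[ta|bt].
  by rewrite mulr_ge0_le0 ?subr_le0// mul0r.
by rewrite [X in _ * X]ifT ?mulr0// mulr_ge0_le0 ?subr_le0.
Qed.

Lemma cvg_flat0 (t : R) : 0 < t -> flat 0 (k.+1%:R * t) @[k --> \oo] --> (1 : R).
Proof.
move=> t0.
have -> : (fun k => flat 0 (k.+1%:R * t)) = (fun k => expR (- (k.+1%:R^-1 * t^-1))).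
  apply/funext => k; rewrite /flat leNgt mulr_gt0// ?ltr0n//=.
  by rewrite expr0 invr1 mul1r invfM.
rewrite -[X in _ --> X]expR0; apply: continuous_cvg; first exact: continuous_expR.
rewrite -oppr0 -[X in - X](mul0r t^-1).
by apply: cvgN; apply: cvgMl; exact: cvg_harmonic.
Qed.

Lemma cvg_bump a b t : a < t < b -> bump a b k t @[k --> \oo] --> (1 : R).
Proof.
move=> /andP[h1 h2]; rewrite -[X in _ --> X]mulr1.
by apply: cvgM; apply: cvg_flat0; rewrite subr_gt0.
Qed.

End smooth1.

(** * Products of bumps *)

Section tensor_functions.
Context {R : realType} {n : nat}.
Implicit Types (h : 'I_n -> R -> R) (x a b : 'rV[R]_n).

Definition tensorf h x : R := \prod_(i < n) h i (x ord0 i).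

Definition derive_factor (j : 'I_n) h : 'I_n -> R -> R :=
  fun i => if i == j then derive1 (h i) else h i.

Lemma smooth1_derive_factor j h : (forall i, smooth1 (h i)) ->
  forall i, smooth1 (derive_factor j h i).
Proof.
by move=> sh i; rewrite /derive_factor; case: ifP => _ //; exact: smooth1_derive1.
Qed.

Lemma continuous_tensorf h : (forall i, continuous (h i)) -> continuous (tensorf h).
Proof.
move=> ch; apply: continuous_big => [|i _ x]; first exact: mul_continuous.
apply: (@continuous_comp _ _ _ (fun x : 'rV[R]_n => x ord0 i) (h i)).
  exact: coord_continuous.
exact: ch.
Qed.

Lemma tensorf_is_derive h j x : (forall i, smooth1 (h i)) ->
  is_derive x (basis_vec j) (tensorf h) (tensorf (derive_factor j h) x).
Proof.
move=> sh; pose c := \prod_(i < n | i != j) h i (x ord0 i).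
have lineE t : tensorf h (t *: basis_vec j + x) =
    (c *: h j) (t *: (1 : R) + x ord0 j).
  rewrite /tensorf (bigD1 j)//= mulrC; congr (_ * _).
    by apply: eq_bigr => i /negbTE ij; rewrite !mxE eqxx /= ij mulr0 add0r.
  by rewrite !mxE !eqxx.
have [[_ d1] d2] := @line_derive_eq R 'rV[R]_n R (tensorf h) (c *: h j) _ _ _ _
    lineE.
have dh := Ck_is_deriveE (x ord0 j) (sh j 1%N).
have dch : is_derive (x ord0 j) 1 (c *: h j) (c *: derive1 (h j) (x ord0 j)).
  exact: is_deriveZ.
apply: DeriveDef; first by apply: d1; case: dch.
rewrite d2; case: dch => _ ->.
rewrite /tensorf (bigD1 j)//= /derive_factor eqxx mulrC; congr (_ * _).
by apply: eq_bigr => i /negbTE ->.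
Qed.

Lemma partial_tensorf h j : (forall i, smooth1 (h i)) ->
  partial j (tensorf h) = tensorf (derive_factor j h).
Proof.
by move=> sh; apply/funext => x; rewrite /partial; case: (tensorf_is_derive j x sh).
Qed.

Lemma partials_tensorf s h : (forall i, smooth1 (h i)) ->
  exists2 h', (forall i, smooth1 (h' i)) & partials s (tensorf h) = tensorf h'.
Proof.
move=> sh; elim: s => [|j s [h' sh' hE]]; first by exists h.
exists (derive_factor j h'); first exact: smooth1_derive_factor.
by rewrite /= hE partial_tensorf.
Qed.

Lemma smooth_tensorf h : (forall i, smooth1 (h i)) -> smooth (tensorf h).
Proof.
move=> sh s; have [h' sh' ->] := partials_tensorf s sh; split.
  by apply: continuous_tensorf => i; exact: (sh' i 0%N).
by move=> i x; case: (tensorf_is_derive i x sh').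
Qed.

(** For products, partial derivatives act on distinct factors or twice on the
same one, so they visibly commute; [ae_partialC] extends this by duality. *)
Lemma partialC_tensorf h i j : (forall i, smooth1 (h i)) ->
  partial i (partial j (tensorf h)) = partial j (partial i (tensorf h)).
Proof.
move=> sh; rewrite !partial_tensorf//; try exact: smooth1_derive_factor.
congr tensorf; apply/funext => k; rewrite /derive_factor.
by case: eqP => [->|_]; case: eqP.
Qed.

Definition bumpf a b (k : nat) : 'rV[R]_n -> R :=
  tensorf (fun i => bump (a ord0 i) (b ord0 i) k).

Lemma bumpf_01 a b k x : 0 <= bumpf a b k x <= 1.
Proof.
rewrite /bumpf /tensorf; elim/big_ind: _ => [|r s|i _]; last exact: bump_01.
  by rewrite ler01 lexx.
by move=> /andP[r0 r1] /andP[s0 s1]; rewrite mulr_ge0// mulr_ile1.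
Qed.

Lemma bumpf_out a b k x : ~ obox a b x -> bumpf a b k x = 0.
Proof.
move=> /existsNP[i /negP xi]; rewrite /bumpf /tensorf (bigD1 i)//=.
by rewrite bump_out ?mul0r.
Qed.

Lemma cvg_bumpf a b x : obox a b x -> bumpf a b k x @[k --> \oo] --> (1 : R).
Proof.
move=> xab; have <- : \prod_(i < n) (1 : R) = 1 by rewrite big1_eq.
apply: cvg_big => [|i _]; first exact: mul_continuous.
exact: cvg_bump.
Qed.

Lemma test_fun_bumpf (Omega : set 'rV[R]_n) a b k :
  cbox a b `<=` Omega -> test_fun Omega (bumpf a b k).
Proof.
move=> abO; have S : closure [set x | bumpf a b k x != 0] `<=` cbox a b.
  have /closure_id -> : closed (cbox a b).
    by apply: compact_closed; [exact: norm_hausdorff|exact: compact_cbox].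
  apply: closure_subset => x /= /eqP; apply: contra_notP => xab.
  by apply: bumpf_out => /sub_obox_cbox.
split.
- by apply: smooth_tensorf => i; exact: smooth1_bump.
- apply: subclosed_compact S; [exact: closed_closure|exact: compact_cbox].
- exact: subset_trans S abO.
Qed.

End tensor_functions.

(** * Integrable functions orthogonal to the bumps *)

Section fundamental_lemma.
Context {R : realType} {n : nat}.
Notation mu := (lebesgue_rV R n).
Implicit Types (a b : 'rV[R]_n) (g : 'rV[R]_n -> R).

Lemma measurable_bumpf a b k : measurable_fun setT (bumpf a b k).
Proof.
apply: continuous_measurable_rV; apply: continuous_tensorf => i.
exact: smooth1_bump 0%N.
Qed.

(** Dominated convergence along the bumps of the box. *)
Lemma integral_obox0 (Omega : set 'rV[R]_n) g a b :
  measurable Omega -> mu.-integrable Omega (EFin \o g) -> cbox a b `<=` Omega ->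
  (forall k, \int[mu]_(x in Omega) (g x * bumpf a b k x) = 0) ->
  (\int[mu]_x ((EFin \o g) \_ (obox a b)) x = 0)%E.
Proof.
move=> mO ig abO g0.
have mg : measurable_fun Omega g by apply/measurable_EFinP; exact:
    measurable_int ig.
have oO : obox a b `<=` Omega := subset_trans (@sub_obox_cbox _ _ a b) abO.
have mgb k : measurable_fun Omega (fun x => g x * bumpf a b k x).
  by apply: measurable_funM => //; apply: measurable_funTS; exact: measurable_bumpf.
have bg k x : `|g x * bumpf a b k x| <= `|g x|.
  have /andP[b0 b1] := bumpf_01 a b k x.
  by rewrite normrM (ger0_norm b0) ler_piMr.
have mgo : measurable_fun (obox a b) (EFin \o g).
  exact: measurable_funS mO oO (measurable_int _ ig).
have igb k : mu.-integrable Omega (EFin \o (fun x => g x * bumpf a b k x)).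
  apply: le_integrable ig => //; first exact/measurable_EFinP.
  by move=> x _; rewrite /= lee_fin.
have [] := @dominated_convergence _ _ _ mu Omega mO
  (fun k x => (g x * bumpf a b k x)%:E) ((EFin \o g) \_ (obox a b)) (fun x =>
      `|g x|%:E).
- by move=> k; exact/measurable_EFinP.
- apply: measurable_funTS.
  exact: (proj1 (measurable_restrictT (EFin \o g) (measurable_obox a b))).
- apply: aeW => x _; rewrite patchE; case: ifPn => [|]; rewrite ?inE
    ?notin_setE => xab.
    apply: cvg_EFin; first by apply: nearW.
    rewrite /= -[X in _ --> X]mulr1.
    by apply: cvgM; [exact: cvg_cst|exact: cvg_bumpf].
  under eq_fun do rewrite bumpf_out// mulr0.
  exact: cvg_cst.
- exact: (integrable_norm ig).
- by apply: aeW => x k _; rewrite /= lee_fin.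
move=> _ _.
have -> : [sequence (\int[mu]_(x in Omega) (g x * bumpf a b k x)%:E)%E]_k = cst 0%E.
  apply/funext => k /=; rewrite -(@fineK _ (integral _ _ _)).
    by have := g0 k; rewrite /Rintegral => ->.
  exact: (integrable_fin_num mO (igb k)).
move=> h; have := cvg_unique _ h (cvg_cst _) => /(_ (@ereal_hausdorff R)) e.
by rewrite -[RHS]e -[RHS]integral_mkcondr setIidr// -integral_mkcond.
Qed.

(** The measurable sets over which [g] integrates to 0 form a lambda-system
containing the boxes, hence all measurable sets. *)
Lemma ae_zero_of_obox g : mu.-integrable setT (EFin \o g) ->
  (forall a b, \int[mu]_(x in obox a b) (g x)%:E = 0)%E ->
  (\int[mu]_x (g x)%:E = 0)%E ->
  ae_eq mu setT (EFin \o g) (cst 0%E).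
Proof.
move=> ig g0 gT0.
pose H := [set A : set 'rV[R]_n | measurable A /\ (\int[mu]_(x in A) (g x)%:E =
    0)%E].
have igS A : measurable A -> mu.-integrable A (EFin \o g).
  by move=> mA; exact: integrableS ig.
have HD A B : B `<=` A -> H A -> H B -> H (A `\` B).
  move=> BA [mA A0] [mB B0]; have mAB : measurable (A `\` B) by exact: measurableD.
  split => //; move: A0; rewrite -{1}(setDUK BA) integral_setU_EFin//.
  - by rewrite B0 add0e.
  - by rewrite (setDUK BA); apply/measurable_EFinP; exact: measurable_int (igS
      _ mA).
  - by apply/disj_setPS => x [Bx [_ /(_ Bx)]].
have lH : lambda_system setT H.
  split => //.
  move=> F ndF HF; split; first by apply: bigcupT_measurable => k; case: (HF k).
  rewrite -eq_bigcup_seqD integral_bigcup.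
  - apply: eseries0 => k _ _; case: k => [|k] /=; first by case: (HF 0%N).
    by case: (HD (F k.+1) (F k)) => //; exact/subsetPset/ndF.
  - exact: trivIset_seqD.
  - move=> [|k] /=; first by case: (HF 0%N).
    by apply: measurableD; [case: (HF k.+1)|case: (HF k)].
  - by apply: igS; apply: bigcupT_measurable => -[|k] /=;
      [case: (HF 0%N)|apply: measurableD; [case: (HF k.+1)|case: (HF k)]].
apply: integral_ae_eq => // E _ mE; rewrite integral_cst// mul0e.
have : (<<s oboxes >>) E by rewrite -measurable_generated_oboxes.
move=> /(@lambda_system_subset _ oboxes _ setT H lH); case=> //.
- by move=> _ _ [a [b ->]] [a' [b' ->]]; do 2 eexists; exact: obox_setI.
- by move=> _ [a [b ->]]; split; [exact: measurable_obox|exact: g0].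
Qed.

(** The boxes inside a fixed box determine the function there, and countably many
rational boxes exhaust [Omega]. *)
Lemma fundamental_bump (Omega : set 'rV[R]_n) g :
  open Omega -> mu.-integrable Omega (EFin \o g) ->
  (forall a b k, cbox a b `<=` Omega ->
     \int[mu]_(x in Omega) (g x * bumpf a b k x) = 0) ->
  ae_eq mu Omega g (cst 0).
Proof.
move=> oO ig g0; have mO := open_measurable_rV oO.
have aeQ p q : cbox p q `<=` Omega ->
    \forall x \ae mu, obox p q x -> g x = 0.
  move=> pqO; have oQ : obox p q `<=` Omega := subset_trans (@sub_obox_cbox _ _
      p q) pqO.
  have mQ := measurable_obox p q.
  have gE : (EFin \o g) \_ (obox p q) = EFin \o (g \_ (obox p q)).
    by rewrite restrict_EFin.
  have intE A : (\int[mu]_(x in A) ((g \_ (obox p q)) x)%:E =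
      \int[mu]_(x in A `&` obox p q) (g x)%:E)%E.
    by rewrite integral_mkcondr gE.
  have box0 a b : cbox a b `<=` Omega ->
      (\int[mu]_(x in obox a b) (g x)%:E = 0)%E.
    move=> abO; rewrite integral_mkcond.
    by apply: (integral_obox0 mO ig abO) => k; exact: g0.
  have : ae_eq mu setT (EFin \o (g \_ (obox p q))) (cst 0%E).
    apply: ae_zero_of_obox.
    - rewrite -gE; apply/(integrable_mkcond _ mQ); exact: integrableS ig.
    - move=> a b; rewrite intE obox_setI.
      apply: box0 => x h; apply: pqO => i.
      have := h i; rewrite !mxE ge_max le_min.
      by move=> /andP[/andP[_ ->] /andP[_ ->]].
    - by rewrite intE setTI; exact: box0.
  by apply: filterS => x /(_ I) /= + xpq; rewrite patchE mem_set// => -[].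
pose P (k : nat) x := if unpickle k is Some pq then
  cbox (ratbox (pq : 'rV[rat]_n * 'rV[rat]_n).1) (ratbox pq.2) `<=` Omega ->
  obox (ratbox pq.1) (ratbox pq.2) x -> g x = 0 else True.
have : \forall x \ae mu, forall k, P k x.
  apply: ae_foralln => k; rewrite /P.
  case: (unpickle k) => [[p q]|]; last exact: aeW.
  have [pqO|pqO] := pselect (cbox (@ratbox R n p) (ratbox q) `<=` Omega).
    by apply: filterS (aeQ _ _ pqO) => x + _.
  by apply: aeW.
apply: filterS => x Px Ox.
have [p [q [xpq pqO]]] := rational_box_nbhs oO Ox.
by have := Px (pickle (p, q)); rewrite /P pickleK /=; exact.
Qed.

End fundamental_lemma.

(** * Square-integrable matrix fields *)

Section ddot.
Context {R : realType}.

Lemma ddotC m n (M N : 'M[R]_(m, n)) : ddot M N = ddot N M.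
Proof. by apply: eq_bigr => i _; apply: eq_bigr => j _; rewrite mulrC. Qed.

Lemma ddot_lin m n (c : R) (M M' N : 'M[R]_(m, n)) :
  ddot (c *: M + M') N = c * ddot M N + ddot M' N.
Proof.
rewrite /ddot mulr_sumr -big_split; apply: eq_bigr => i _ /=.
rewrite mulr_sumr -big_split; apply: eq_bigr => j _ /=.
by rewrite !mxE mulrDl mulrA.
Qed.

Lemma ddot_ge0 m n (M : 'M[R]_(m, n)) : 0 <= ddot M M.
Proof. by apply: sumr_ge0 => i _; apply: sumr_ge0 => j _; rewrite -expr2
    sqr_ge0. Qed.

Lemma ddot11 (x y : R) : ddot (const_mx x : 'M[R]_1) (const_mx y) = x * y.
Proof. by rewrite /ddot !big_ord1 !mxE. Qed.

(** The tensor [ttr P] is the adjoint of [P] for the Frobenius product. *)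
Lemma ddot_tapp d (P : tensor4 R d) (M N : 'M[R]_d) :
  ddot (tapp P M) N = ddot M (tapp (ttr P) N).
Proof.
transitivity (\sum_p \sum_q P p.1 p.2 q.1 q.2 * M q.1 q.2 * N p.1 p.2).
  rewrite /ddot pair_bigA; apply: eq_bigr => p _ /=.
  by rewrite mxE pair_bigA mulr_suml.
rewrite exchange_big /ddot [RHS]pair_bigA; apply: eq_bigr => q _ /=.
rewrite mxE pair_bigA mulr_sumr; apply: eq_bigr => p _ /=.
by rewrite /ttr mulrCA mulrA.
Qed.

End ddot.

Section L2_theory.
Context {R : realType} {d : nat}.
Variable Omega : set 'rV[R]_d.
Hypothesis mO : measurable Omega.
Notation mu := (lebesgue_rV R d).
Implicit Types u v w : 'rV[R]_d -> R.

Lemma L2_integrableM u v : L2 Omega u -> L2 Omega v ->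
  mu.-integrable Omega (EFin \o (fun x => u x * v x)).
Proof.
move=> [mu_ iu] [mv iv]; apply: le_integrable (integrableD mO iu iv) => //.
  by apply/measurable_EFinP; exact: measurable_funM.
move=> x Ox /=; rewrite lee_fin [leRHS]ger0_norm ?addr_ge0 ?sqr_ge0//.
rewrite ler_norml; have := sqr_ge0 (u x + v x); have := sqr_ge0 (u x - v x).
by have := sqr_ge0 (u x); have := sqr_ge0 (v x); rewrite !expr2; nra.
Qed.

Lemma L2_lin c u v : L2 Omega u -> L2 Omega v -> L2 Omega (fun x => c * u x + v x).
Proof.
move=> Lu Lv; have mc : measurable_fun Omega (fun x => c * u x + v x).
  by apply: measurable_funD; [apply: measurable_funM => //; case: Lu|case: Lv].
split => //; have [_ iu] := Lu; have [_ iv] := Lv.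
have i := integrableD mO (integrableD mO (integrableZl mO (c ^+ 2) iu)
  (integrableZl mO (c + c) (L2_integrableM Lu Lv))) iv.
apply: eq_integrable i => // x _ /=.
by rewrite -!EFinM -!EFinD; congr EFin; ring.
Qed.

Lemma L2_cst0 : L2 Omega (fun=> 0).
Proof.
split; first exact: measurable_cst.
by apply: (@eq_integrable _ _ _ mu _ mO (cst 0%E)) => [x _ /=|]; rewrite
    ?expr0n//; exact: integrable0.
Qed.

Lemma L2Z c u : L2 Omega u -> L2 Omega (fun x => c * u x).
Proof.
move=> Lu; have := L2_lin c Lu L2_cst0; congr L2.
by apply/funext => x; rewrite addr0.
Qed.

Lemma L2D u v : L2 Omega u -> L2 Omega v -> L2 Omega (fun x => u x + v x).
Proof.
move=> Lu Lv; have := L2_lin 1 Lu Lv; congr L2.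
by apply/funext => x; rewrite mul1r.
Qed.

Lemma L2_sum (I : Type) (s : seq I) (F : I -> 'rV[R]_d -> R) :
  (forall i, L2 Omega (F i)) -> L2 Omega (fun x => \sum_(i <- s) F i x).
Proof.
move=> LF; elim: s => [|i s IH].
  by have := L2_cst0; congr L2; apply/funext => x; rewrite big_nil.
have := L2D (LF i) IH; congr L2.
by apply/funext => x; rewrite big_cons.
Qed.

Section matrices.
Variables (m n : nat).
Implicit Types xi phi chi : 'rV[R]_d -> 'M[R]_(m, n).

Lemma L2mx_lin c xi phi : L2mx Omega xi -> L2mx Omega phi ->
  L2mx Omega (fun x => c *: xi x + phi x).
Proof.
move=> Lx Lp i j; have := L2_lin c (Lx i j) (Lp i j); congr L2.
by apply/funext => x; rewrite !mxE.
Qed.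

Lemma L2mxB xi phi : L2mx Omega xi -> L2mx Omega phi ->
  L2mx Omega (fun x => xi x - phi x).
Proof.
move=> Lx Lp i j; have := L2_lin (-1) (Lp i j) (Lx i j); congr L2.
by apply/funext => x; rewrite !mxE mulN1r addrC.
Qed.

Lemma L2mx_ddot_integrable xi phi : L2mx Omega xi -> L2mx Omega phi ->
  mu.-integrable Omega (EFin \o (fun x => ddot (xi x) (phi x))).
Proof.
move=> Lx Lp.
have : mu.-integrable Omega
    (fun x => \sum_(i <- index_enum 'I_m) \sum_(j <- index_enum 'I_n) (xi x i j
        * phi x i j)%:E)%E.
  apply: integrable_sum => // i _; apply: integrable_sum => // j _.
  exact: L2_integrableM.
apply: eq_integrable => // x _ /=; rewrite -sumEFin; apply: eq_bigr => i _.
by rewrite -sumEFin.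
Qed.

Lemma ipmxC xi phi : ipmx Omega xi phi = ipmx Omega phi xi.
Proof. by apply: eq_Rintegral => x _; rewrite ddotC. Qed.

Lemma ipmx_lin c xi phi chi : L2mx Omega xi -> L2mx Omega phi -> L2mx Omega chi ->
  ipmx Omega (fun x => c *: xi x + phi x) chi =
  c * ipmx Omega xi chi + ipmx Omega phi chi.
Proof.
move=> Lx Lp Lc; have i1 := L2mx_ddot_integrable Lx Lc.
have i2 := L2mx_ddot_integrable Lp Lc.
rewrite /ipmx -RintegralZl// -RintegralD//.
  by apply: eq_Rintegral => x _; rewrite ddot_lin.
have := integrableZl mO c i1.
by apply: eq_integrable => // x _ /=; rewrite EFinM.
Qed.

Lemma ipmxBl xi phi chi : L2mx Omega xi -> L2mx Omega phi -> L2mx Omega chi ->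
  ipmx Omega (fun x => xi x - phi x) chi =
  ipmx Omega xi chi - ipmx Omega phi chi.
Proof.
move=> Lx Lp Lc; have := ipmx_lin (-1) Lp Lx Lc.
rewrite mulN1r addrC => <-; congr ipmx.
by apply/funext => x; rewrite scaleN1r addrC.
Qed.

Lemma ipmxBr xi phi chi : L2mx Omega xi -> L2mx Omega phi -> L2mx Omega chi ->
  ipmx Omega chi (fun x => xi x - phi x) =
  ipmx Omega chi xi - ipmx Omega chi phi.
Proof. by move=> *; rewrite ipmxC ipmxBl// ![ipmx _ _ chi]ipmxC. Qed.

Lemma ipmx_ge0 xi : 0 <= ipmx Omega xi xi.
Proof. by apply: Rintegral_ge0 => x _; exact: ddot_ge0. Qed.

Lemma norm2mx_ge0 xi : 0 <= norm2mx Omega xi.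
Proof. exact: sqrtr_ge0. Qed.

Lemma sqr_norm2mx xi : norm2mx Omega xi ^+ 2 = ipmx Omega xi xi.
Proof. by rewrite sqr_sqrtr// ipmx_ge0. Qed.

Lemma sqr_norm2mx_lin c xi phi : L2mx Omega xi -> L2mx Omega phi ->
  norm2mx Omega (fun x => c *: xi x + phi x) ^+ 2 =
  c ^+ 2 * norm2mx Omega xi ^+ 2 + 2 * c * ipmx Omega xi phi + norm2mx Omega
      phi ^+ 2.
Proof.
move=> Lx Lp; have Lc := L2mx_lin c Lx Lp.
rewrite !sqr_norm2mx ipmx_lin// (ipmxC xi) (ipmxC phi) !ipmx_lin//.
by rewrite (ipmxC phi xi); ring.
Qed.

(** The squared norm of [c *: xi + phi] is a nonnegative polynomial in [c]. *)
Lemma cauchy_schwarz xi phi : L2mx Omega xi -> L2mx Omega phi ->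
  `|ipmx Omega xi phi| <= norm2mx Omega xi * norm2mx Omega phi.
Proof.
move=> Lx Lp; have pos c : 0 <= c ^+ 2 * norm2mx Omega xi ^+ 2 +
    2 * c * ipmx Omega xi phi + norm2mx Omega phi ^+ 2.
  by rewrite -sqr_norm2mx_lin// sqr_ge0.
rewrite -(@ler_pXn2r _ 2)// ?nnegrE ?mulr_ge0 ?norm2mx_ge0// exprMn real_normK
    ?num_real//.
move: pos (norm2mx_ge0 xi) (norm2mx_ge0 phi).
set a := norm2mx _ xi; set b := norm2mx _ phi; set p := ipmx _ _ _.
move=> pos a0 b0; have [az|a_neq0] := eqVneq a 0.
  have [->|p_neq0] := eqVneq p 0; first by rewrite expr0n mulr_ge0// sqr_ge0.
  (* The polynomial is affine in [c], and takes the value -1 here. *)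
  have := pos (- (b ^+ 2 + 1) / (2 * p)).
  rewrite az expr0n mulr0 add0r (_ : 2 * _ * p = - (b ^+ 2 + 1)); last by field.
  by lra.
have a2 : 0 < a ^+ 2 by rewrite exprn_gt0// lt_def a_neq0.
(* The minimiser of the polynomial. *)
have := pos (- p / a ^+ 2); rewrite (_ : _ + _ + _ = b ^+ 2 - p ^+ 2 / a ^+ 2);
    last by field.
by rewrite subr_ge0 ler_pdivrMr// mulrC.
Qed.

Lemma norm2mx_lin c xi phi : L2mx Omega xi -> L2mx Omega phi ->
  norm2mx Omega (fun x => c *: xi x + phi x) <=
  `|c| * norm2mx Omega xi + norm2mx Omega phi.
Proof.
move=> Lx Lp.
rewrite -(@ler_pXn2r _ 2)// ?nnegrE ?addr_ge0 ?mulr_ge0 ?norm2mx_ge0//.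
rewrite sqr_norm2mx_lin// sqrrD lerD2r exprMn real_normK ?num_real// lerD2l.
rewrite -mulrA -[leRHS]mulr_natl -[_ * norm2mx Omega xi * _]mulrA ler_pM2l//.
rewrite (le_trans (ler_norm _))// normrM ler_wpM2l//.
exact: cauchy_schwarz.
Qed.

Lemma norm2mxB xi phi : L2mx Omega xi -> L2mx Omega phi ->
  norm2mx Omega (fun x => xi x - phi x) <= norm2mx Omega xi + norm2mx Omega phi.
Proof.
move=> Lx Lp; have := norm2mx_lin (-1) Lp Lx.
rewrite normrN1 mul1r addrC; congr (_ <= _); congr norm2mx.
by apply/funext => x; rewrite scaleN1r addrC.
Qed.

Lemma norm2mxBC xi phi :
  norm2mx Omega (fun x => xi x - phi x) = norm2mx Omega (fun x => phi x - xi x).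
Proof.
congr Num.sqrt; apply: eq_Rintegral => x _.
by apply: eq_bigr => i _; apply: eq_bigr => j _; rewrite !mxE; ring.
Qed.

Lemma norm2mx_dist3 xi chi phi : L2mx Omega xi -> L2mx Omega phi -> L2mx Omega
    chi ->
  norm2mx Omega (fun x => xi x - phi x) <=
  norm2mx Omega (fun x => xi x - chi x) + norm2mx Omega (fun x => chi x - phi x).
Proof.
move=> Lx Lp Lc; rewrite [X in _ + X]norm2mxBC.
have := norm2mxB (L2mxB Lx Lc) (L2mxB Lp Lc); congr (_ <= _); congr norm2mx.
by apply/funext => x; rewrite opprB addrA subrK.
Qed.

Lemma ae_eq_ipmx xi xi' phi phi' : L2mx Omega xi -> L2mx Omega xi' ->
  L2mx Omega phi -> L2mx Omega phi' ->
  ae_eq mu Omega xi xi' -> ae_eq mu Omega phi phi' ->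
  ipmx Omega xi phi = ipmx Omega xi' phi'.
Proof.
move=> Lx Lx' Lp Lp' ex ep; congr fine; apply: ae_eq_integral => //.
- exact: measurable_int (L2mx_ddot_integrable Lx Lp).
- exact: measurable_int (L2mx_ddot_integrable Lx' Lp').
by move: ex ep; apply: filterS2 => x e1 e2 Ox; rewrite e1// e2.
Qed.

Lemma ae_eq_norm2mx xi xi' : L2mx Omega xi -> L2mx Omega xi' ->
  ae_eq mu Omega xi xi' -> norm2mx Omega xi = norm2mx Omega xi'.
Proof. by move=> Lx Lx' e; congr Num.sqrt; exact: ae_eq_ipmx. Qed.

Lemma ipmx_sum xi phi : L2mx Omega xi -> L2mx Omega phi ->
  ipmx Omega xi phi =
  \sum_i \sum_j ip Omega (fun x => xi x i j) (fun x => phi x i j).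
Proof.
move=> Lx Lp; rewrite /ipmx /Rintegral.
under eq_integral do rewrite -sumEFin.
rewrite integral_sum//=; last first.
  move=> i; have : mu.-integrable Omega
      (fun x => \sum_(j <- index_enum 'I_n) (xi x i j * phi x i j)%:E)%E.
    by apply: integrable_sum => // j _; exact: L2_integrableM.
  by apply: eq_integrable => // x _; rewrite -sumEFin.
rewrite (eq_bigr (fun i => (\sum_j ip Omega (fun x => xi x i j) (fun x => phi x
    i j))%:E)).
  by rewrite sumEFin.
move=> i _; under eq_integral do rewrite -sumEFin.
rewrite integral_sum//=; last by move=> j; exact: L2_integrableM.
rewrite -sumEFin; apply: eq_bigr => j _; rewrite /ip /Rintegral fineK//.
exact: (integrable_fin_num mO (L2_integrableM _ _)).
Qed.

End matrices.
End L2_theory.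

(** * Square-integrable functions *)

Lemma sum_sqr_le (R : realDomainType) (I : Type) (s : seq I) (F : I -> R) :
  (forall i, 0 <= F i) -> \sum_(i <- s) F i ^+ 2 <= (\sum_(i <- s) F i) ^+ 2.
Proof.
move=> F0; elim: s => [|i s IH]; first by rewrite !big_nil expr0n.
rewrite !big_cons sqrrD -addrA lerD2l (le_trans IH)// lerDr.
by rewrite mulrn_wge0// mulr_ge0// sumr_ge0.
Qed.

Section scalar_L2.
Context {R : realType} {d : nat}.
Variable Omega : set 'rV[R]_d.
Hypothesis mO : measurable Omega.
Notation mu := (lebesgue_rV R d).
Implicit Types u v w : 'rV[R]_d -> R.

Let sc u : 'rV[R]_d -> 'M[R]_1 := fun x => const_mx (u x).

Let L2sc u : L2 Omega u -> L2mx Omega (sc u).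
Proof. by move=> Lu i j; move: Lu; congr L2; apply/funext => x; rewrite mxE. Qed.

Let ipsc u v : ip Omega u v = ipmx Omega (sc u) (sc v).
Proof. by apply: eq_Rintegral => x _; rewrite ddot11. Qed.

Let norm2sc u : norm2 Omega u = norm2mx Omega (sc u).
Proof. by rewrite /norm2 ipsc. Qed.

Let sc_lin c u v : sc (fun x => c * u x + v x) = fun x => c *: sc u x + sc v x.
Proof. by apply/funext => x; apply/matrixP => i j; rewrite !mxE. Qed.

Lemma ipC u v : ip Omega u v = ip Omega v u.
Proof. by rewrite !ipsc ipmxC. Qed.

Lemma ip_lin c u v w : L2 Omega u -> L2 Omega v -> L2 Omega w ->
  ip Omega (fun x => c * u x + v x) w = c * ip Omega u w + ip Omega v w.
Proof. by move=> Lu Lv Lw; rewrite !ipsc sc_lin ipmx_lin//; exact: L2sc. Qed.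

Lemma L2B u v : L2 Omega u -> L2 Omega v -> L2 Omega (fun x => u x - v x).
Proof.
move=> Lu Lv; have := L2_lin mO (-1) Lv Lu; congr L2.
by apply/funext => x; rewrite mulN1r addrC.
Qed.

Lemma ipBl u v w : L2 Omega u -> L2 Omega v -> L2 Omega w ->
  ip Omega (fun x => u x - v x) w = ip Omega u w - ip Omega v w.
Proof.
move=> Lu Lv Lw; have := ip_lin (-1) Lv Lu Lw; rewrite mulN1r addrC => <-.
by congr ip; apply/funext => x; rewrite mulN1r addrC.
Qed.

Lemma ipBr u v w : L2 Omega u -> L2 Omega v -> L2 Omega w ->
  ip Omega w (fun x => u x - v x) = ip Omega w u - ip Omega w v.
Proof. by move=> *; rewrite ipC ipBl// !(ipC w). Qed.

Lemma ip0l w : ip Omega (fun=> 0) w = 0.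
Proof.
rewrite -[RHS](mul0r (fine (mu Omega))) -Rintegral_cst//.
by apply: eq_Rintegral => x _; rewrite mul0r.
Qed.

Lemma ip_suml (I : Type) (s : seq I) (F : I -> 'rV[R]_d -> R) w :
  (forall i, L2 Omega (F i)) -> L2 Omega w ->
  ip Omega (fun x => \sum_(i <- s) F i x) w = \sum_(i <- s) ip Omega (F i) w.
Proof.
move=> LF Lw; elim: s => [|i s IH].
  rewrite big_nil -[RHS](ip0l w); congr ip.
  by apply/funext => x; rewrite big_nil.
rewrite big_cons -IH -[ip _ (F i) w]mul1r -ip_lin//; last exact: L2_sum.
by congr ip; apply/funext => x; rewrite big_cons mul1r.
Qed.

Lemma norm2_ge0 u : 0 <= norm2 Omega u.
Proof. exact: sqrtr_ge0. Qed.

Lemma norm2_lin c u v : L2 Omega u -> L2 Omega v ->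
  norm2 Omega (fun x => c * u x + v x) <= `|c| * norm2 Omega u + norm2 Omega v.
Proof. by move=> Lu Lv; rewrite !norm2sc sc_lin norm2mx_lin//; exact: L2sc. Qed.

Lemma norm2_0 : norm2 Omega (fun=> 0) = 0.
Proof. by rewrite /norm2 ip0l sqrtr0. Qed.

Lemma norm2_sum (I : Type) (s : seq I) (c : I -> R) (F : I -> 'rV[R]_d -> R) :
  (forall i, L2 Omega (F i)) ->
  norm2 Omega (fun x => \sum_(i <- s) c i * F i x) <=
  \sum_(i <- s) `|c i| * norm2 Omega (F i).
Proof.
move=> LF; elim: s => [|i s IH].
  rewrite (_ : (fun x => _) = fun=> 0) ?norm2_0 ?big_nil//.
  by apply/funext => x; rewrite big_nil.
rewrite big_cons; apply: le_trans (lerD (lexx _) IH).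
have LS : L2 Omega (fun x => \sum_(j <- s) c j * F j x).
  by apply: (L2_sum mO) => j; exact: L2Z.
have := norm2_lin (c i) (LF i) LS; congr (norm2 _ _ <= _).
by apply/funext => x; rewrite big_cons.
Qed.

Lemma cauchy_schwarz_ip u v : L2 Omega u -> L2 Omega v ->
  `|ip Omega u v| <= norm2 Omega u * norm2 Omega v.
Proof. by move=> Lu Lv; rewrite ipsc !norm2sc cauchy_schwarz//; exact: L2sc. Qed.

Lemma ae_eq_ip u u' v : L2 Omega u -> L2 Omega u' -> L2 Omega v ->
  ae_eq mu Omega u u' -> ip Omega u v = ip Omega u' v.
Proof.
move=> Lu Lu' Lv uu'; rewrite !ipsc; apply: ae_eq_ipmx; try exact: L2sc => //.
- exact: mO.
- by apply: filterS uu' => x /[apply] e; rewrite /sc e.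
- exact: ae_eq_refl.
Qed.

Lemma ae_eq_norm2 u u' : L2 Omega u -> L2 Omega u' ->
  ae_eq mu Omega u u' -> norm2 Omega u = norm2 Omega u'.
Proof.
move=> Lu Lu' e; rewrite /norm2 (ae_eq_ip Lu Lu' Lu e) ipC.
by rewrite (ae_eq_ip Lu Lu' Lu' e).
Qed.

Lemma norm2mx_le_sum m n (xi : 'rV[R]_d -> 'M[R]_(m, n)) : L2mx Omega xi ->
  norm2mx Omega xi <= \sum_i \sum_j norm2 Omega (fun x => xi x i j).
Proof.
move=> Lx; rewrite -(@ler_pXn2r _ 2)// ?nnegrE ?norm2mx_ge0//; last first.
  by apply: sumr_ge0 => i _; apply: sumr_ge0 => j _; exact: norm2_ge0.
rewrite sqr_norm2mx ipmx_sum//.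
rewrite !pair_bigA /=; set F := fun p : 'I_m * 'I_n => norm2 Omega (fun x => xi
    x p.1 p.2).
rewrite (eq_bigr (fun p => F p ^+ 2)) => [|p _]; last first.
  rewrite /F /norm2 sqr_sqrtr// /ip; apply: Rintegral_ge0 => x _.
  by rewrite -expr2 sqr_ge0.
have F0 p : 0 <= F p by exact: norm2_ge0.
exact: sum_sqr_le.
Qed.
End scalar_L2.

(** * Test functions *)

Section test_functions.
Context {R : realType} {d : nat}.
Variable Omega : set 'rV[R]_d.
Hypotheses (oO : open Omega) (bO : bounded_set Omega).
Notation mu := (lebesgue_rV R d).
Implicit Types (u v g phi psi : 'rV[R]_d -> R) (i j : 'I_d).

Let mO : measurable Omega. Proof. exact: open_measurable_rV. Qed.

Lemma bounded_sub_cube : exists M : R, Omega `<=` cube M.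
Proof.
have [M [_ hM]] := bO; exists (M + 1) => x /(hM (M + 1)) /=.
rewrite ltrDl => /(_ ltr01) xM i.
by rewrite !mxE -ler_norml (le_trans (normr_coord_le x i)).
Qed.

Lemma bounded_measure_lty : (mu Omega < +oo)%E.
Proof.
have [M OM] := bounded_sub_cube.
apply: le_lt_trans (lebesgue_rV_cbox (const_mx (- M)) (const_mx M)).
by apply: le_measure => //; rewrite inE//; exact: measurable_cbox.
Qed.

Lemma test_fun_out phi x : test_fun Omega phi -> ~ Omega x -> phi x = 0.
Proof.
move=> [_ _ SO] xO; apply/eqP; apply: contra_notT xO => phix.
by apply: SO; exact: subset_closure.
Qed.

Lemma test_fun_continuous phi : test_fun Omega phi -> continuous phi.
Proof. by move=> [/(_ [::])[]]. Qed.

Lemma test_fun_derivable phi i x : test_fun Omega phi -> derivable phi x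
    (basis_vec i).
Proof. by move=> [/(_ [::])[]]. Qed.

Lemma test_fun_bounded phi : test_fun Omega phi -> exists C, forall x, `|phi x|
    <= C.
Proof.
move=> tphi; have [M OM] := bounded_sub_cube.
apply: (@bounded_out_cube _ _ M); first exact: test_fun_continuous.
by move=> x xM; apply: (test_fun_out tphi) => /OM.
Qed.

Lemma L2_bounded u C : measurable_fun setT u -> (forall x, `|u x| <= C) -> L2
    Omega u.
Proof.
move=> mu_ uC; split; first exact: measurable_funTS.
apply: measurable_bounded_integrable => //.
- exact: bounded_measure_lty.
- by apply: measurable_funX; exact: measurable_funTS.
exists (C ^+ 2); split; first exact: num_real.
move=> K CK x _ /=; rewrite (le_trans _ (ltW CK))// normrX.
by rewrite lerXn2r ?nnegrE// (le_trans _ (uC x)).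
Qed.

Lemma L2_test_fun phi : test_fun Omega phi -> L2 Omega phi.
Proof.
move=> tphi; have [C hC] := test_fun_bounded tphi.
apply: (@L2_bounded _ C) => //.
by apply: continuous_measurable_rV; exact: test_fun_continuous.
Qed.

(** Off the closed support the function vanishes on a neighbourhood, hence so
does its derivative. *)
Lemma test_fun_partial i phi : test_fun Omega phi -> test_fun Omega (partial i phi).
Proof.
move=> [sm cS SO]; pose S := closure [set x | phi x != 0].
have dS : closure [set x | partial i phi x != 0] `<=` S.
  rewrite (closure_id S).1; last exact: closed_closure.
  apply: closure_subset => x /= /eqP; apply: contra_notP => xS.
  rewrite /partial (@near_eq_derive _ _ _ phi (cst 0)); first exact: derive_cst.
  have : nbhs x (~` S).
    by apply: open_nbhs_nbhs; split => //; rewrite openC; exact: closed_closure.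
  apply: filterS => y yS; apply/eqP; apply: contra_notT yS => phiy.
  exact: subset_closure.
split.
- by move=> s; have := sm (rcons s i); rewrite /partials foldr_rcons.
- by apply: subclosed_compact dS => //; exact: closed_closure.
- exact: subset_trans dS SO.
Qed.

(** The product [phi * psi] vanishes outside [Omega], so its derivative
integrates to 0 over the whole space. *)
Lemma test_fun_integration_by_parts i phi psi :
  test_fun Omega phi -> test_fun Omega psi ->
  ip Omega phi (partial i psi) = - ip Omega (partial i phi) psi.
Proof.
move=> tphi tpsi; have [M OM] := bounded_sub_cube.
have tdphi := test_fun_partial i tphi; have tdpsi := test_fun_partial i tpsi.
have dE : partial i (phi * psi) =
    fun x => phi x * partial i psi x + partial i phi x * psi x.
  apply/funext => x; rewrite /partial deriveM; try exact: test_fun_derivable.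
  by rewrite /GRing.scale /= [psi x * _]mulrC.
have i1 := L2_integrableM mO (L2_test_fun tphi) (L2_test_fun tdpsi).
have i2 := L2_integrableM mO (L2_test_fun tdphi) (L2_test_fun tpsi).
apply/eqP; rewrite -addr_eq0 /ip -RintegralD//; apply/eqP.
have -> : \int[mu]_(x in Omega) (phi x * partial i psi x + partial i phi x *
    psi x) =
    \int[mu]_x partial i (phi * psi) x.
  rewrite Rintegral_mkcond; apply: eq_Rintegral => x _; rewrite dE patchE.
  case: ifPn => //; rewrite notin_setE => xO.
  by rewrite (test_fun_out tphi xO) (test_fun_out tpsi xO) mul0r mulr0 addr0.
rewrite /Rintegral (@integral_partial0 _ _ i M)//.
- by move=> x; apply: derivableM; exact: test_fun_derivable.
- by move=> x; apply: continuousM; exact: test_fun_continuous.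
- rewrite dE => x.
  by apply: (@continuousD _ _ _ (phi * partial i psi) (partial i phi * psi));
    apply: continuousM; exact: test_fun_continuous.
- move=> x xM; rewrite [LHS](_ : _ = phi x * psi x)//.
  by rewrite (test_fun_out tphi) ?mul0r// => /OM.
Qed.

Lemma L2_integrable u : L2 Omega u -> mu.-integrable Omega (EFin \o u).
Proof.
move=> Lu; have L1 : L2 Omega (cst 1).
  by apply: (@L2_bounded _ 1); [exact: measurable_cst|move=> x; rewrite normr1].
have := L2_integrableM mO Lu L1; congr integrable.
by apply/funext => x /=; rewrite mulr1.
Qed.

Lemma ae_eq_of_bumps u v : L2 Omega u -> L2 Omega v ->
  (forall a b k, cbox a b `<=` Omega ->
     ip Omega u (bumpf a b k) = ip Omega v (bumpf a b k)) ->
  ae_eq mu Omega u v.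
Proof.
move=> Lu Lv uv; have Luv := L2B mO Lu Lv.
have : ae_eq mu Omega (fun x => u x - v x) (cst 0).
  apply: fundamental_bump => //; first exact: L2_integrable.
  move=> a b k abO; have Lb := L2_test_fun (test_fun_bumpf k abO).
  by have := ipBl mO Lu Lv Lb; rewrite uv// subrr.
by apply: filterS => x /[apply] /eqP; rewrite subr_eq0 => /eqP.
Qed.

(** The fundamental lemma of the calculus of variations; it makes the weak
operators, which are defined by a choice, unique almost everywhere. *)
Lemma ae_eq_of_test u v : L2 Omega u -> L2 Omega v ->
  (forall phi, test_fun Omega phi -> ip Omega u phi = ip Omega v phi) ->
  ae_eq mu Omega u v.
Proof.
move=> Lu Lv uv; apply: ae_eq_of_bumps => // a b k abO.
by apply: uv; exact: test_fun_bumpf.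
Qed.

(** Two integrations by parts move both derivatives onto a bump, where they
commute by [partialC_tensorf]. *)
Lemma ae_partialC i j phi : test_fun Omega phi ->
  ae_eq mu Omega (partial i (partial j phi)) (partial j (partial i phi)).
Proof.
move=> tphi; have tij a b := test_fun_partial a (test_fun_partial b tphi).
apply: ae_eq_of_bumps; try exact: L2_test_fun.
move=> a b k abO; have tb := test_fun_bumpf k abO.
have parts a' b' : ip Omega (partial a' (partial b' phi)) (bumpf a b k) =
    ip Omega phi (partial b' (partial a' (bumpf a b k))).
  rewrite -[LHS]opprK -test_fun_integration_by_parts//; last exact:
      test_fun_partial.
  by rewrite [RHS]test_fun_integration_by_parts//; exact: test_fun_partial.
have bC : partial j (partial i (bumpf a b k)) = partial i (partial j (bumpf a b k)).
  exact: (partialC_tensorf j i (fun l => smooth1_bump (a ord0 l) (b ord0 l) k)).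
by apply: (etrans (parts i j)); rewrite bC; exact: esym (parts j i).
Qed.

End test_functions.

(** * Weak derivatives and Sobolev spaces *)

Section weak_derivatives.
Context {R : realType} {d : nat}.
Variable Omega : set 'rV[R]_d.
Hypotheses (oO : open Omega) (bO : bounded_set Omega).
Notation mu := (lebesgue_rV R d).
Notation wp := (weak_partial Omega).
Implicit Types (u v g : 'rV[R]_d -> R) (phi psi : 'rV[R]_d -> R) (i j : 'I_d).

Let mO : measurable Omega. Proof. exact: open_measurable_rV. Qed.
Let L2t phi : test_fun Omega phi -> L2 Omega phi. Proof. exact: L2_test_fun. Qed.
Let tp i phi : test_fun Omega phi -> test_fun Omega (partial i phi).
Proof. exact: test_fun_partial. Qed.

Lemma weak_partial_spec i u g : L2 Omega g -> is_weak_partial Omega i u g ->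
  [/\ L2 Omega (wp i u), is_weak_partial Omega i u (wp i u)
    & ae_eq mu Omega (wp i u) g].
Proof.
move=> Lg ug; rewrite /weak_partial.
case: xgetP => [w _ [Lw uw]|/(_ g)]; last by case.
split => //; apply: (ae_eq_of_test oO bO) => // phi tphi.
by apply: oppr_inj; rewrite -uw// -ug.
Qed.

(** Weak derivatives see a function only through its pairings with test
functions, so the chosen representatives coincide. *)
Lemma weak_partial_ext i u v :
  (forall phi, test_fun Omega phi -> ip Omega u phi = ip Omega v phi) ->
  wp i u = wp i v.
Proof.
move=> uv; rewrite /weak_partial; congr xget; apply/seteqP.
by split => g /= [Lg wg]; split => // phi tphi;
  rewrite -wg// uv//; exact: tp.
Qed.

Lemma is_weak_partial_lin i c u v g h :
  L2 Omega u -> L2 Omega v -> L2 Omega g -> L2 Omega h ->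
  is_weak_partial Omega i u g -> is_weak_partial Omega i v h ->
  is_weak_partial Omega i (fun x => c * u x + v x) (fun x => c * g x + h x).
Proof.
move=> Lu Lv Lg Lh ug vh phi tphi.
have Lp := L2t tphi; have Ldp := L2t (tp i tphi).
by rewrite !ip_lin// ug// vh// opprD mulrN.
Qed.

Lemma sobolev_L2 m u : sobolev Omega m u -> L2 Omega u.
Proof. by case: m => [|m] []. Qed.

Lemma sobolev_ext m u v : sobolev Omega m u -> L2 Omega v ->
  (forall phi, test_fun Omega phi -> ip Omega u phi = ip Omega v phi) ->
  sobolev Omega m v.
Proof.
case: m => [|m] [Lu Du] Lv uv; split => // i.
have [g [ug sg]] := Du i; exists g; split => // phi tphi.
by rewrite -uv ?ug//; exact: tp.
Qed.

(** The derivative witnessing [sobolev] and the chosen one have the same pairings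
with test functions, so regularity passes from the former to the latter. *)
Lemma sobolev_weak_partial m u i : sobolev Omega m.+1 u ->
  is_weak_partial Omega i u (wp i u) /\ sobolev Omega m (wp i u).
Proof.
move=> [Lu /(_ i)[g [ug sg]]]; have Lg := sobolev_L2 sg.
have [Lw uw _] := weak_partial_spec Lg ug; split => //.
apply: (sobolev_ext sg Lw) => phi tphi.
by apply: oppr_inj; rewrite -uw// -ug.
Qed.

Lemma sobolev_S m u : sobolev Omega m.+1 u -> sobolev Omega m u.
Proof.
elim: m u => [|m IH] u [Lu Du]; split => // i.
by have [g [ug sg]] := Du i; exists g; split => //; exact: IH.
Qed.

Lemma sobolev_lin m c u v : sobolev Omega m u -> sobolev Omega m v ->
  sobolev Omega m (fun x => c * u x + v x).
Proof.
elim: m u v => [|m IH] u v [Lu Du] [Lv Dv]; split => //; try exact: L2_lin.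
move=> i; have [g [ug sg]] := Du i; have [h [vh sh]] := Dv i.
exists (fun x => c * g x + h x); split; last exact: IH.
by apply: is_weak_partial_lin => //; [exact: sobolev_L2 sg|exact: sobolev_L2 sh].
Qed.

(** Linearity holds only almost everywhere, by uniqueness of weak derivatives. *)
Lemma weak_partial_lin i c u v : sobolev Omega 1 u -> sobolev Omega 1 v ->
  ae_eq mu Omega (wp i (fun x => c * u x + v x)) (fun x => c * wp i u x + wp i v x).
Proof.
move=> su sv; have [uw [Luw _]] := sobolev_weak_partial i su.
have [vw [Lvw _]] := sobolev_weak_partial i sv.
have Lw := L2_lin mO c Luw Lvw.
by have [] := weak_partial_spec Lw (is_weak_partial_lin c (sobolev_L2 su)
    (sobolev_L2 sv) Luw Lvw uw vw).
Qed.

Lemma test_fun_weak_partial i phi : test_fun Omega phi ->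
  is_weak_partial Omega i phi (partial i phi).
Proof. by move=> tphi psi tpsi; exact: test_fun_integration_by_parts. Qed.

Lemma sobolev_test_fun m phi : test_fun Omega phi -> sobolev Omega m phi.
Proof.
elim: m phi => [|m IH] phi tphi; (split; first exact: L2t) => // i.
by exists (partial i phi); split; [exact: test_fun_weak_partial|exact/IH/tp].
Qed.

Lemma weak_partial_test i phi : test_fun Omega phi ->
  ae_eq mu Omega (wp i phi) (partial i phi).
Proof.
by move=> t; case: (weak_partial_spec (L2t (tp i t)) (test_fun_weak_partial i t)).
Qed.

Lemma weak_partial_ae_ext i u v : L2 Omega u -> L2 Omega v ->
  ae_eq mu Omega u v -> wp i u = wp i v.
Proof.
move=> Lu Lv uv; apply: weak_partial_ext => phi /L2t Lp.
exact: (ae_eq_ip mO Lu Lv Lp uv).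
Qed.

Lemma weak_partial2_test i j phi : test_fun Omega phi ->
  ae_eq mu Omega (wp j (wp i phi)) (partial j (partial i phi)).
Proof.
move=> t; have [_ [Lw _]] := sobolev_weak_partial i (sobolev_test_fun 1 t).
rewrite (weak_partial_ae_ext j Lw (L2t (tp i t)) (weak_partial_test i t)).
exact: weak_partial_test (tp i t).
Qed.

Lemma sobolev_sqnorm_ge0 m u : 0 <= sobolev_sqnorm Omega m u.
Proof.
elim: m u => [|m IH] u /=; rewrite addr_ge0 ?sqr_ge0//.
by apply: sumr_ge0.
Qed.

Lemma norm2_le_sobolev m u : norm2 Omega u <= sobolev_norm Omega m u.
Proof.
rewrite -[norm2 Omega u]ger0_norm ?norm2_ge0// -sqrtr_sqr ler_wsqrtr//.
case: m => [|m] /=; rewrite lerDl//.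
by apply: sumr_ge0 => i _; exact: sobolev_sqnorm_ge0.
Qed.

Lemma weak_partial_le_sobolev m u i :
  sobolev_norm Omega m (wp i u) <= sobolev_norm Omega m.+1 u.
Proof.
rewrite ler_wsqrtr//= (bigD1 i)//= addrCA lerDl addr_ge0 ?sqr_ge0//.
by apply: sumr_ge0 => k _; exact: sobolev_sqnorm_ge0.
Qed.

(** The definition of [H20] controls chosen weak derivatives of a difference;
uniqueness turns them into differences of derivatives. *)
Lemma H20_approx u e : H20 Omega u -> 0 < e ->
  exists phi, [/\ test_fun Omega phi,
    norm2 Omega (fun x => u x - phi x) < e,
    forall i, norm2 Omega (fun x => wp i u x - partial i phi x) < e &
    forall i j, norm2 Omega (fun x => wp j (wp i u) x - partial j (partial i
        phi) x) < e].
Proof.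
move=> [su approx] e0; have [phi tphi close] := approx e e0.
have diffE v w : (fun x => v x - w x) = (fun x => -1 * w x + v x) :> ('rV[R]_d
    -> R).
  by apply/funext => x; rewrite mulN1r addrC.
have sp := sobolev_test_fun 2 tphi.
have D1 i : ae_eq mu Omega (wp i (fun x => u x - phi x))
    (fun x => wp i u x - partial i phi x).
  rewrite !diffE; apply: ae_eq_trans (weak_partial_lin _ _ (sobolev_S sp)
      (sobolev_S su)) _.
  by have := weak_partial_test i tphi; apply: filterS => x /[apply] ->.
have sd : sobolev Omega 2 (fun x => u x - phi x) by rewrite diffE; exact:
    sobolev_lin.
have Lw1 i : L2 Omega (wp i u).
  by have [_ /sobolev_L2] := sobolev_weak_partial i su.
have Ld1 i : L2 Omega (fun x => wp i u x - partial i phi x).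
  exact: (L2B mO (Lw1 i) (L2t (tp i tphi))).
have D2 i j : ae_eq mu Omega (wp j (wp i (fun x => u x - phi x)))
    (fun x => wp j (wp i u) x - partial j (partial i phi) x).
  have Lw : L2 Omega (wp i (fun x => u x - phi x)).
    by have [_ /sobolev_L2] := sobolev_weak_partial i sd.
  rewrite (weak_partial_ae_ext j Lw (Ld1 i) (D1 i)) !diffE.
  have [_ s1] := sobolev_weak_partial i su.
  apply: ae_eq_trans (weak_partial_lin _ _ (sobolev_test_fun 1 (tp i tphi)) s1) _.
  by have := weak_partial_test j (tp i tphi); apply: filterS => x /[apply] ->.
exists phi; split => //.
- exact: le_lt_trans (norm2_le_sobolev 2 _) close.
- move=> i; have [_ /sobolev_L2 Lw] := sobolev_weak_partial i sd.
  rewrite -(ae_eq_norm2 mO Lw (Ld1 i) (D1 i)); apply: le_lt_trans close.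
  exact: le_trans (norm2_le_sobolev 1 _) (weak_partial_le_sobolev 1 _ i).
- move=> i j; have [_ sw] := sobolev_weak_partial i sd.
  have [_ /sobolev_L2 Lw] := sobolev_weak_partial j sw.
  have [_ s1] := sobolev_weak_partial i su.
  have [_ /sobolev_L2 Lw2] := sobolev_weak_partial j s1.
  rewrite -(ae_eq_norm2 mO Lw (L2B mO Lw2 (L2t (tp j (tp i tphi)))) (D2 i j)).
  apply: le_lt_trans close.
  apply: le_trans (weak_partial_le_sobolev 1 _ i).
  exact: le_trans (norm2_le_sobolev 0 _) (weak_partial_le_sobolev 0 _ j).
Qed.

Lemma sobolev_sqnorm_ae0 m u : L2 Omega u -> ae_eq mu Omega u (fun=> 0) ->
  sobolev_sqnorm Omega m u = 0.
Proof.
have L0 : L2 Omega (fun=> 0) := L2_cst0 mO.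
elim: m u => [|m IH] u Lu u0 /=;
  rewrite (ae_eq_norm2 mO Lu L0 u0) norm2_0// expr0n add0r//.
apply: big1 => i _; rewrite (weak_partial_ae_ext i Lu L0 u0).
have w0 : is_weak_partial Omega i (fun=> 0) (fun=> 0).
  by move=> psi _; rewrite !ip0l// oppr0.
have [Lw _ wp0] := weak_partial_spec L0 w0.
exact: IH.
Qed.

Lemma test_fun_H20 phi : test_fun Omega phi -> H20 Omega phi.
Proof.
move=> tphi; split; first exact: sobolev_test_fun.
move=> e e0; exists phi => //.
rewrite (_ : (fun x => _) = fun=> 0); last by apply/funext => x; rewrite subrr.
rewrite /sobolev_norm sobolev_sqnorm_ae0 ?sqrtr0//; first exact: L2_cst0.
exact: ae_eq_refl.
Qed.

End weak_derivatives.

(** * Integration by parts in H^2_0 *)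

Section tensor_composition.
Context {R : realType} {d : nat}.

Definition tcomp (P Q : tensor4 R d) : tensor4 R d := fun i j k l =>
  \sum_a \sum_b P i j a b * Q a b k l.

Lemma tapp_comp (P Q : tensor4 R d) (N : 'M[R]_d) :
  tapp P (tapp Q N) = tapp (tcomp P Q) N.
Proof.
apply/matrixP => i j; rewrite !mxE.
transitivity (\sum_p \sum_q P i j p.1 p.2 * (Q p.1 p.2 q.1 q.2 * N q.1 q.2)).
  rewrite pair_bigA; apply: eq_bigr => p _ /=.
  by rewrite mxE pair_bigA mulr_sumr.
rewrite exchange_big [RHS]pair_bigA; apply: eq_bigr => q _ /=.
rewrite /tcomp pair_bigA mulr_suml; apply: eq_bigr => p _ /=.
by rewrite mulrA.
Qed.

End tensor_composition.

Section green.
Context {R : realType} {d : nat}.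
Variable Omega : set 'rV[R]_d.
Hypotheses (oO : open Omega) (bO : bounded_set Omega).
Notation mu := (lebesgue_rV R d).
Notation wp := (weak_partial Omega).
Implicit Types (u v g : 'rV[R]_d -> R) (phi psi : 'rV[R]_d -> R) (i j : 'I_d).

Let mO : measurable Omega. Proof. exact: open_measurable_rV. Qed.
Let L2t phi : test_fun Omega phi -> L2 Omega phi. Proof. exact: L2_test_fun. Qed.
Let tp i phi : test_fun Omega phi -> test_fun Omega (partial i phi).
Proof. exact: test_fun_partial. Qed.

Lemma L2_weak_partial m u i : sobolev Omega m.+1 u -> L2 Omega (wp i u).
Proof.
by move=> su; have [_ /sobolev_L2] := sobolev_weak_partial oO bO i su.
Qed.

Lemma L2mx_grad u : sobolev Omega 1 u -> L2mx Omega (grad Omega u).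
Proof.
move=> su i j; have := L2_weak_partial j su; congr L2.
by apply/funext => x; rewrite mxE.
Qed.

Lemma L2_weak_partial2 m u i j : sobolev Omega m.+2 u -> L2 Omega (wp j (wp i u)).
Proof.
by move=> su; have [_ /L2_weak_partial] := sobolev_weak_partial oO bO i su; exact.
Qed.

Lemma L2mx_hess m u : sobolev Omega m.+2 u -> L2mx Omega (hess Omega u).
Proof.
move=> su i j; have := L2_weak_partial2 i j su; congr L2.
by apply/funext => x; rewrite mxE.
Qed.

Lemma L2mx_tapp (P : tensor4 R d) (xi : 'rV[R]_d -> 'M[R]_d) :
  L2mx Omega xi -> L2mx Omega (fun x => tapp P (xi x)).
Proof.
move=> Lx i j; rewrite (_ : (fun x => _) =
    fun x => \sum_k \sum_l P i j k l * xi x k l).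
  by apply: (L2_sum mO) => k; apply: (L2_sum mO) => l; exact: (L2Z mO _ (Lx k l)).
by apply/funext => x; rewrite mxE.
Qed.

Lemma ipmx_tapp (P : tensor4 R d) (xi phi : 'rV[R]_d -> 'M[R]_d) :
  ipmx Omega (fun x => tapp P (xi x)) phi =
  ipmx Omega xi (fun x => tapp (ttr P) (phi x)).
Proof. by apply: eq_Rintegral => x _; rewrite ddot_tapp. Qed.

(** An integration-by-parts identity against test functions passes to the
limit along the test functions approximating an element of [H20]. *)
Lemma pairing_limit (v u' : 'I_d -> 'rV[R]_d -> R) g u :
  (forall j, L2 Omega (v j)) -> (forall j, L2 Omega (u' j)) ->
  L2 Omega g -> L2 Omega u ->
  (forall phi, test_fun Omega phi ->
     \sum_j ip Omega (v j) (partial j phi) = - ip Omega g phi) ->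
  (forall e, 0 < e -> exists2 phi, test_fun Omega phi &
     norm2 Omega (fun x => u x - phi x) < e /\
     forall j, norm2 Omega (fun x => u' j x - partial j phi x) < e) ->
  \sum_j ip Omega (v j) (u' j) = - ip Omega g u.
Proof.
move=> Lv Lu' Lg Lu test approx; apply/eqP; rewrite -addr_eq0 -normr_eq0.
set A := _ + _; pose K := \sum_j norm2 Omega (v j) + norm2 Omega g.
have K0 : 0 <= K by rewrite addr_ge0 ?norm2_ge0// sumr_ge0// => j _; exact:
    norm2_ge0.
have K1 : 0 < K + 1 by rewrite ltr_wpDl.
suff Ae e : 0 < e -> `|A| <= 0 + e.
  by rewrite eq_le normr_ge0 andbT; apply/ler_addgt0Pr.
move=> e0; have [phi tphi [uphi duphi]] := approx (e / (K + 1)) (divr_gt0 e0 K1).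
have Ldp j : L2 Omega (partial j phi) by exact/L2t/tp.
have -> : A = \sum_j ip Omega (v j) (fun x => u' j x - partial j phi x) +
    ip Omega g (fun x => u x - phi x).
  rewrite (ipBr mO Lu (L2t tphi) Lg).
  rewrite (eq_bigr (fun j => ip Omega (v j) (u' j) - ip Omega (v j) (partial j
      phi))).
    by rewrite sumrB test// opprK /A; ring.
  by move=> j _; rewrite (ipBr mO (Lu' j) (Ldp j) (Lv j)).
rewrite add0r (le_trans (ler_normD _ _))//.
have : K * (e / (K + 1)) <= e by rewrite mulrCA ger_pMr// ler_pdivrMr// mul1r lerDl.
apply: le_trans; rewrite /K mulrDl; apply: lerD.
  rewrite (le_trans (ler_norm_sum _ _ _))// mulr_suml ler_sum// => j _.
  apply: le_trans (cauchy_schwarz_ip mO (Lv j) (L2B mO (Lu' j) (Ldp j))) _.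
  by rewrite ler_wpM2l ?norm2_ge0// ltW.
apply: le_trans (cauchy_schwarz_ip mO Lg (L2B mO Lu (L2t tphi))) _.
by rewrite ler_wpM2l ?norm2_ge0// ltW.
Qed.

(** For test functions the identity is the definition of the weak derivatives of
[grad u]; [pairing_limit] then puts [u] itself in place of the test function. *)
Lemma green_laplacian u : H20 Omega u ->
  ip Omega (laplacian Omega u) u = - ipmx Omega (grad Omega u) (grad Omega u).
Proof.
move=> Hu; have [su _] := Hu; have s1 := sobolev_S su.
have Lg i := L2_weak_partial i s1; have L2h i j := L2_weak_partial2 i j su.
have lapE : laplacian Omega u = fun x => \sum_i wp i (wp i u) x.
  by apply/funext => x; apply: eq_bigr => i _; rewrite mxE.
have Llap : L2 Omega (laplacian Omega u).
  by rewrite lapE; apply: (L2_sum mO) => i; exact: L2h.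
have gradE : ipmx Omega (grad Omega u) (grad Omega u) =
    \sum_j ip Omega (wp j u) (wp j u).
  rewrite (ipmx_sum mO (L2mx_grad s1) (L2mx_grad s1)) big_ord1.
  by apply: eq_bigr => j _; congr ip; apply/funext => x; rewrite mxE.
apply: oppr_inj; rewrite opprK gradE; apply/esym.
apply: (pairing_limit Lg Lg Llap (sobolev_L2 s1)).
  move=> phi tphi; rewrite lapE (ip_suml mO _ (fun i => L2h i i) (L2t tphi)) -sumrN.
  apply: eq_bigr => j _; have [_ s1j] := sobolev_weak_partial oO bO j su.
  by have [wj _] := sobolev_weak_partial oO bO j s1j; exact: wj.
move=> e e0; have [phi [tphi h1 h2 _]] := H20_approx oO bO Hu e0.
by exists phi.
Qed.

Lemma ipmx_row_partial i (xi : 'rV[R]_d -> 'M[R]_d) phi :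
  L2mx Omega xi -> test_fun Omega phi ->
  ipmx Omega (fun x => row i (xi x)) (fun x => \row_j partial j phi x) =
  \sum_j ip Omega (fun x => xi x i j) (partial j phi).
Proof.
move=> Lx tphi; rewrite (ipmx_sum mO).
- rewrite big_ord1; apply: eq_bigr => j _.
  by congr ip; apply/funext => x; rewrite mxE.
- by move=> k j; have := Lx i j; congr L2; apply/funext => x; rewrite mxE.
- move=> k j; have := L2t (tp j tphi); congr L2.
  by apply/funext => x; rewrite mxE.
Qed.

(** Row by row: the partial derivatives of the test functions approximating [u]
are themselves test functions, which approximate the rows of [grad u]. *)
Lemma green_rowdiv (xi : 'rV[R]_d -> 'M[R]_d) (g : 'rV[R]_d -> 'rV[R]_d) u :
  L2mx Omega xi -> L2mx Omega g -> is_weak_rowdiv Omega xi g -> H20 Omega u ->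
  ipmx Omega xi (hess Omega u) = - ipmx Omega g (grad Omega u).
Proof.
move=> Lx Lg wg Hu; have [su _] := Hu; have s1 := sobolev_S su.
rewrite (ipmx_sum mO Lx (L2mx_hess su)) (ipmx_sum mO Lg (L2mx_grad s1)) big_ord1.
rewrite -sumrN; apply: eq_bigr => i _.
have -> : (fun x => grad Omega u x ord0 i) = wp i u by apply/funext => x;
    rewrite mxE.
rewrite (eq_bigr (fun j => ip Omega (fun x => xi x i j) (wp j (wp i u)))); last
    first.
  by move=> j _; congr ip; apply/funext => x; rewrite mxE.
apply: pairing_limit.
- by move=> j; exact: Lx.
- by move=> j; exact: L2_weak_partial2 su.
- exact: Lg.
- exact: L2_weak_partial s1.
- by move=> phi tphi; rewrite wg// opprK ipmx_row_partial.
move=> e e0; have [phi [tphi _ h1 h2]] := H20_approx oO bO Hu e0.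
exists (partial i phi); first exact: tp.
by split => [|j]; [exact: (h1 i)|exact: (h2 i j)].
Qed.

(** The two orders of derivation are reconciled by [ae_partialC]. *)
Lemma hess_test phi : test_fun Omega phi ->
  ae_eq mu Omega (hess Omega phi)
    (fun x => \matrix_(i, j) partial i (partial j phi) x).
Proof.
move=> tphi.
have H (p : 'I_d * 'I_d) : ae_eq mu Omega (wp p.2 (wp p.1 phi)) (partial p.1
    (partial p.2 phi)).
  apply: ae_eq_trans (weak_partial2_test oO bO p.1 p.2 tphi) _.
  exact: ae_partialC.
(* The finitely many exceptional sets are gathered through an enumeration. *)
have : \forall x \ae mu, forall k, if unpickle k is Some p then
    Omega x -> wp (p : 'I_d * 'I_d).2 (wp p.1 phi) x = partial p.1 (partial p.2
        phi) x else True.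
  apply: ae_foralln => k; case: (unpickle k) => [p|]; last exact: aeW.
  exact: H.
apply: filterS => x Hx Ox; apply/matrixP => i j; rewrite !mxE.
by have := Hx (pickle (i, j)); rewrite pickleK /=; exact.
Qed.

(** Test functions belong to [H20], so the equation satisfied by [u] says that [f]
is a weak [hessdiv] of the flux; uniqueness concludes. *)
Lemma hessdiv_source (B : tensor4 R d) f u : L2 Omega f -> sobolev Omega 2 u ->
  (forall v, H20 Omega v -> aform Omega B u v = ip Omega f v) ->
  L2 Omega (hessdiv Omega (fun y => tapp (ttr B) (tapp B (hess Omega u y)))) /\
  ae_eq mu Omega (hessdiv Omega (fun y => tapp (ttr B) (tapp B (hess Omega u
      y)))) f.
Proof.
move=> Lf su eqn; set xi := fun y => _.
have Lxi : L2mx Omega xi by do 2 apply: L2mx_tapp; exact: L2mx_hess su.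
have wf : is_weak_hessdiv Omega xi f.
  move=> phi tphi; rewrite -eqn; last exact: test_fun_H20.
  rewrite /aform ipmxC ipmx_tapp ipmxC.
  have Lh := L2mx_hess (sobolev_test_fun oO bO 2 tphi).
  have Lh' : L2mx Omega (fun x => \matrix_(i, j) partial i (partial j phi) x).
    move=> i j; have := L2t (tp i (tp j tphi)); congr L2.
    by apply/funext => x; rewrite mxE.
  exact: (ae_eq_ipmx mO Lxi Lxi Lh Lh' (ae_eq_refl _ _ _) (hess_test tphi)).
rewrite /hessdiv; case: xgetP => [w _ [Lw ww]|/(_ f)]; last by case.
split => //; apply: (ae_eq_of_test oO bO) => // phi tphi.
by rewrite ww// wf.
Qed.

(** As [B] is constant, the row divergence of the flux is a combination, with
constant coefficients, of the third derivatives of [phi]. *)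
Lemma rowdiv_spec (B : tensor4 R d) phi : sobolev Omega 3 phi ->
  let xi := fun y => tapp (ttr B) (tapp B (hess Omega phi y)) in
  [/\ L2mx Omega (rowdiv Omega xi), is_weak_rowdiv Omega xi (rowdiv Omega xi) &
    norm2mx Omega (rowdiv Omega xi) <=
      (\sum_i \sum_j \sum_(p : 'I_d * 'I_d) `|tcomp (ttr B) B i j p.1 p.2|) *
      sobolev_norm Omega 3 phi].
Proof.
move=> s3; set M := tcomp _ _; move=> xi.
have Lxi : L2mx Omega xi by do 2 apply: L2mx_tapp; exact: L2mx_hess s3.
have xiE i j : (fun x => xi x i j) =
    fun x => \sum_(p : 'I_d * 'I_d) M i j p.1 p.2 * wp p.2 (wp p.1 phi) x.
  apply/funext => x; rewrite /xi tapp_comp mxE pair_bigA; apply: eq_bigr => p _.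
  by rewrite mxE.
have s1 k l : sobolev Omega 1 (wp l (wp k phi)).
  have [_ s2] := sobolev_weak_partial oO bO k s3.
  by have [] := sobolev_weak_partial oO bO l s2.
have L3 j k l : L2 Omega (wp j (wp l (wp k phi))) := L2_weak_partial j (s1 k l).
pose G i j x := \sum_(p : 'I_d * 'I_d) M i j p.1 p.2 * wp j (wp p.2 (wp p.1 phi)) x.
have LG i j : L2 Omega (G i j).
  by apply: (L2_sum mO) => p; exact: (L2Z mO _ (L3 j p.1 p.2)).
pose g x : 'rV[R]_d := \row_i \sum_j G i j x.
have gE i : (fun x => g x ord0 i) = fun x => \sum_j G i j x.
  by apply/funext => x; rewrite mxE.
have Lg : L2mx Omega g.
  by move=> k i; rewrite (ord1 k) gE; exact: (L2_sum mO _ (LG i)).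
have ipG i j psi : test_fun Omega psi ->
    ip Omega (fun x => xi x i j) (partial j psi) = - ip Omega (G i j) psi.
  move=> tpsi; have Lp := L2t tpsi; have Ldp := L2t (tp j tpsi).
  have Ls1 (p : 'I_d * 'I_d) := L2Z mO (M i j p.1 p.2) (sobolev_L2 (s1 p.1 p.2)).
  have Ls2 (p : 'I_d * 'I_d) := L2Z mO (M i j p.1 p.2) (L3 j p.1 p.2).
  rewrite xiE; apply: (etrans (ip_suml mO _ Ls1 Ldp)).
  apply: etrans (congr1 -%R (esym (ip_suml mO _ Ls2 Lp))); rewrite -sumrN.
  apply: eq_bigr => p _.
  have ipZ w w' : L2 Omega w -> L2 Omega w' ->
      ip Omega (fun x => M i j p.1 p.2 * w x) w' = M i j p.1 p.2 * ip Omega w w'.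
    move=> Lw Lw'; have := ip_lin mO (M i j p.1 p.2) Lw (L2_cst0 mO) Lw'.
    rewrite ip0l// addr0 => <-; congr ip; apply/funext => x; by rewrite addr0.
  apply: (etrans (ipZ _ _ (sobolev_L2 (s1 p.1 p.2)) Ldp)).
  apply: etrans (congr1 -%R (esym (ipZ _ _ (L3 j p.1 p.2) Lp))); rewrite -mulrN.
  congr (_ * _); have [w _] := sobolev_weak_partial oO bO j (s1 p.1 p.2).
  exact: w.
have wg : is_weak_rowdiv Omega xi g.
  move=> i psi tpsi; rewrite (ipmx_row_partial i Lxi tpsi) gE.
  rewrite (ip_suml mO _ (LG i) (L2t tpsi)) -sumrN.
  by apply: eq_bigr => j _; rewrite ipG// opprK.
rewrite /rowdiv; case: xgetP => [w _ [Lw ww]|/(_ g)]; last by case.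
split => //; apply: le_trans (norm2mx_le_sum mO Lw) _.
rewrite big_ord1 mulr_suml; apply: ler_sum => i _.
rewrite (_ : norm2 _ _ = norm2 Omega (fun x => \sum_j G i j x)); last first.
  rewrite -gE; apply: (ae_eq_norm2 mO (Lw ord0 i) (Lg ord0 i)).
  apply: (ae_eq_of_test oO bO) => // psi tpsi.
  by rewrite ww// wg.
have -> : (fun x => \sum_j G i j x) = fun x => \sum_j 1 * G i j x.
  by apply/funext => x; apply: eq_bigr => j _; rewrite mul1r.
apply: le_trans (norm2_sum mO _ _ (LG i)) _.
rewrite mulr_suml; apply: ler_sum => j _; rewrite normr1 mul1r.
apply: le_trans (norm2_sum mO _ _ (fun p : 'I_d * 'I_d => L3 j p.1 p.2)) _.
rewrite mulr_suml; apply: ler_sum => p _; apply: ler_wpM2l => //.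
apply: le_trans (weak_partial_le_sobolev _ 2 _ p.1).
apply: le_trans (weak_partial_le_sobolev _ 1 _ p.2).
apply: le_trans (weak_partial_le_sobolev _ 0 _ j).
exact: norm2_le_sobolev.
Qed.

End green.

(** * Norms in finite dimension *)

Section finite_dimension.
Context {R : realType} (X : vectType R).
Implicit Types (v w : X).

Let n := \dim (@fullv R X).
Let b := vbasis (@fullv R X).
Let lc (x : 'rV[R]_n) : X := \sum_(i < n) x ord0 i *: b`_i.
Let crd w : 'rV[R]_n := \row_i coord b i w.

Let crdK w : lc (crd w) = w.
Proof.
rewrite /lc [RHS](coord_vbasis (memvf w)); apply: eq_bigr => i _.
by rewrite mxE.
Qed.

Let lc_lin c x y : lc (c *: x + y) = c *: lc x + lc y.
Proof.
rewrite /lc scaler_sumr -big_split; apply: eq_bigr => i _ /=.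
by rewrite !mxE scalerDl scalerA.
Qed.

Let lcB x y : lc (x - y) = lc x - lc y.
Proof. by rewrite addrC -scaleN1r lc_lin scaleN1r addrC. Qed.

Let lcZ c x : lc (c *: x) = c *: lc x.
Proof.
have lc0 : lc 0 = 0 by rewrite -(subrr 0) lcB subrr.
by have := lc_lin c x 0; rewrite lc0 !addr0.
Qed.

Lemma seminorm_le_coord (p : X -> R) : p 0 <= 0 ->
  (forall c v w, p (c *: v + w) <= `|c| * p v + p w) -> (forall w, 0 <= p w) ->
  exists2 K, 0 <= K & forall x : 'rV[R]_n, p (lc x) <= K * `|x|.
Proof.
move=> p0 plin pge0; exists (\sum_(i < n) p b`_i); first exact: sumr_ge0.
move=> x; rewrite mulr_suml /lc.
elim/big_rec2: _ => // i K v _ pv.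
apply: le_trans (plin _ _ _) _; rewrite lerD// mulrC ler_wpM2l//.
exact: normr_coord_le.
Qed.

(** The norm is continuous in coordinates and positive on the unit sphere, which
is compact, so it has a positive minimum there. *)
Lemma finite_dim_seminorm_le (N p : X -> R) : is_norm N -> p 0 <= 0 ->
  (forall c v w, p (c *: v + w) <= `|c| * p v + p w) -> (forall w, 0 <= p w) ->
  exists2 K, 0 <= K & forall w, p w <= K * N w.
Proof.
move=> [N_eq0 NZ ND] p0 plin pge0.
have N0 : N 0 = 0 by rewrite -(scale0r (0 : X)) NZ normr0 mul0r.
have NN w : N (- w) = N w by rewrite -scaleN1r NZ normrN1 mul1r.
have Nge0 w : 0 <= N w.
  by have := ND w (- w); rewrite subrr N0 NN -mulr2n pmulrn_lge0.
have Nlin c v w : N (c *: v + w) <= `|c| * N v + N w.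
  by rewrite -NZ; exact: ND.
have [K K0 pK] := seminorm_le_coord p0 plin pge0.
have [L L0 NL] : exists2 L, 0 <= L & forall x : 'rV[R]_n, N (lc x) <= L * `|x|.
  by apply: seminorm_le_coord => //; rewrite N0.
have NB v w : `|N v - N w| <= N (v - w).
  rewrite ler_distlC lerBlDr; apply/andP; split.
    by have := ND (v - w) w; rewrite subrK addrC.
  by have := ND (w - v) v; rewrite subrK -opprB NN addrC.
have cN : continuous (N \o lc).
  move=> x A /nbhs_ballP[e e0 eA]; have e0' : 0 < e by [].
  have L1 : 0 < L + 1 by rewrite ltr_wpDl.
  apply/nbhs_ballP; exists (e / (L + 1)); first exact: divr_gt0.
  move=> y; rewrite -ball_normE /= => xy; apply: eA.
  rewrite /ball /= (le_lt_trans (NB _ _))// -lcB (le_lt_trans (NL _))//.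
  have : L * `|x - y| <= (L + 1) * `|x - y| by rewrite ler_wpM2r// lerDl.
  by move=> /le_lt_trans; apply; rewrite mulrC -ltr_pdivlMr.
pose S := [set x : 'rV[R]_n | `|x| = 1].
have cS : compact S.
  apply: bounded_closed_compact.
    by exists 1; split => // M M1 x /= ->; exact: ltW.
  rewrite (_ : S = (fun x : 'rV[R]_n => `|x|) @^-1` [set 1]).
    apply: closed_comp => [x _|]; first exact: norm_continuous.
    exact: closed_eq.
  by [].
have pN (c : R) : 0 < c -> (forall x, S x -> c <= N (lc x)) ->
    forall w, p w <= (K / c) * N w.
  move=> c0 hc w; rewrite -(crdK w); set x := crd w.
  apply: le_trans (pK x) _; rewrite -mulrA ler_wpM2l// ler_pdivlMl//.
  have [->|x0] := eqVneq x 0; first by rewrite normr0 mulr0.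
  have nx0 : 0 < `|x| by rewrite normr_gt0.
  have := hc (`|x|^-1 *: x); rewrite /S /= normrZ normfV normr_id mulVf ?gt_eqF//.
  move=> /(_ erefl); rewrite lcZ NZ normfV normr_id.
  by rewrite ler_pdivlMl// mulrC.
have [S0|/set0P SN0] := eqVneq S set0.
  exists (K / 1); first by rewrite divr1.
  by apply: pN => // x; rewrite S0.
have [x0 Sx0 x0min] := EVT_min_rV SN0 cS (continuous_subspaceT cN).
have Nx0 : 0 < N (lc x0).
  rewrite lt_def Nge0 andbT; apply/eqP => /N_eq0 lc0.
  move: Sx0; rewrite inE /S /=.
  have -> : x0 = 0.
    have /freeP fb : free b by have /andP[] := vbasisP (@fullv R X).
    apply/rowP => i; rewrite mxE; exact: (fb (fun i => x0 ord0 i)).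
  by rewrite normr0 => /esym/eqP; rewrite oner_eq0.
exists (K / N (lc x0)); first by rewrite divr_ge0.
by apply: pN => // x Sx; apply: x0min; rewrite inE.
Qed.

End finite_dimension.

(** * Accuracy measures and the energy error *)

(** Some bound [K] must be known before the supremum says anything: without it
[sup] takes the default value 0. *)
Lemma sup_quotient (R : realType) (X : lmodType R) (N F : X -> R) (K : R) :
  is_norm N -> (forall w, 0 <= F w) -> (forall w, F w <= K * N w) ->
  let s := sup [set r | exists2 w, w != 0 & r = F w / N w] in
  0 <= s /\ forall w, F w <= s * N w.
Proof.
move=> [N_eq0 NZ ND] F0 FK s.
have N0 : N 0 = 0 by rewrite -(scale0r (0 : X)) NZ normr0 mul0r.
have NN w : N (- w) = N w by rewrite -scaleN1r NZ normrN1 mul1r.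
have Nge0 w : 0 <= N w.
  by have := ND w (- w); rewrite subrr N0 NN -mulr2n pmulrn_lge0.
have Ngt0 w : w != 0 -> 0 < N w.
  by move=> w0; rewrite lt_def Nge0 andbT; apply: contra w0 => /eqP/N_eq0 ->.
have ub : ubound [set r | exists2 w, w != 0 & r = F w / N w] K.
  by move=> _ [w w0 ->]; rewrite ler_pdivrMr ?Ngt0.
have le_s w : w != 0 -> F w / N w <= s.
  by move=> w0; apply: ub_le_sup; [exists K|exists w].
split.
  have [[r [w w0 _]]|S0] := pselect ([set r | exists2 w, w != 0 & r = F w / N
      w] !=set0).
    by apply: le_trans (le_s w w0); rewrite divr_ge0.
  by rewrite /s sup_out// => -[].
move=> w; have [->|w0] := eqVneq w 0.
  by rewrite N0 mulr0; have := FK 0; rewrite N0 mulr0.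
by rewrite -ler_pdivrMr ?Ngt0// le_s.
Qed.

Section discretisation.
Context {R : realType} {d : nat}.
Variable Omega : set 'rV[R]_d.
Hypotheses (oO : open Omega) (bO : bounded_set Omega).
Variable D : hessian_disc Omega.
Notation mu := (lebesgue_rV R d).
Implicit Types (v w : XD D).

Let mO : measurable Omega. Proof. exact: open_measurable_rV. Qed.

Let norm2mx_0 m n : norm2mx Omega (fun=> 0 : 'M[R]_(m, n)) = 0.
Proof.
rewrite /norm2mx /ipmx (_ : (fun x => _) = fun=> 0).
  by rewrite Rintegral_cst// mul0r sqrtr0.
by apply/funext => x; apply: big1 => i _; apply: big1 => j _; rewrite mxE mul0r.
Qed.

Section reconstruction.
Variables (m n : nat) (L : XD D -> 'rV[R]_d -> 'M[R]_(m, n)).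
Hypotheses (LL2 : forall w, L2mx Omega (L w)) (Llin : ae_linear Omega L).

Lemma ae_linearB v w : ae_eq mu Omega (L (v - w)) (fun x => L v x - L w x).
Proof.
have := Llin (-1) w v; rewrite scaleN1r addrC; apply: filterS => x /[apply] ->.
by rewrite scaleN1r addrC.
Qed.

Lemma ipmx_linearB (xi : 'rV[R]_d -> 'M[R]_(m, n)) v w : L2mx Omega xi ->
  ipmx Omega xi (L (v - w)) = ipmx Omega xi (L v) - ipmx Omega xi (L w).
Proof.
move=> Lx; rewrite -(ipmxBr mO (LL2 v) (LL2 w) Lx).
exact: (ae_eq_ipmx mO Lx Lx (LL2 _) (L2mxB mO (LL2 v) (LL2 w)) (ae_eq_refl _ _
    _) (ae_linearB v w)).
Qed.

(** This is where the finite dimension of [XD D] enters. *)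
Lemma reconstruction_bounded :
  exists K, forall w, norm2mx Omega (L w) <= K * norm2mx Omega (hessD w).
Proof.
have [|||K _ hK] := @finite_dim_seminorm_le R (XD D)
  (fun w => norm2mx Omega (hessD w)) (fun w => norm2mx Omega (L w))
  (hessD_norm D); last by exists K.
- have e := ae_linearB 0 0; rewrite subrr in e.
  rewrite (ae_eq_norm2mx mO (LL2 0) (L2mxB mO (LL2 0) (LL2 0)) e).
  rewrite (_ : (fun x => _) = fun=> 0); last by apply/funext => x; rewrite subrr.
  by rewrite norm2mx_0.
- move=> c v w; rewrite (ae_eq_norm2mx mO (LL2 _) (L2mx_lin mO c (LL2 v) (LL2
    w)) (Llin c v w)).
  exact: norm2mx_lin.
- by move=> w; exact: norm2mx_ge0.
Qed.

End reconstruction.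

Variable (B : tensor4 R d).

Lemma calWtD_split chi w :
  L2mx Omega (fun x => tapp B (chi x)) ->
  L2mx Omega (rowdiv Omega (fun y => tapp (ttr B) (tapp B (chi y)))) ->
  calWtD B chi w = ipmx Omega (fun x => tapp B (chi x)) (hessD w) +
    ipmx Omega (rowdiv Omega (fun y => tapp (ttr B) (tapp B (chi y)))) (gradD w).
Proof.
move=> Lc Lr; rewrite /calWtD RintegralD//.
  exact: (L2mx_ddot_integrable mO Lc (hessD_L2 w)).
exact: (L2mx_ddot_integrable mO Lr (gradD_L2 w)).
Qed.

Lemma WtD_bound chi :
  L2mx Omega (fun x => tapp B (chi x)) ->
  L2mx Omega (rowdiv Omega (fun y => tapp (ttr B) (tapp B (chi y)))) ->
  0 <= WtD B D chi /\
  forall w, `|calWtD B chi w| <= WtD B D chi * norm2mx Omega (hessD w).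
Proof.
move=> Lc Lr; set r := rowdiv _ _ in Lr.
have [K hK] := reconstruction_bounded (@gradD_L2 _ _ _ D) (@gradD_linear _ _ _ D).
apply: (@sup_quotient _ _ _ (fun w => `|calWtD B chi w|)
    (norm2mx Omega (fun x => tapp B (chi x)) + norm2mx Omega r * K) (hessD_norm
        D)) => // w.
rewrite calWtD_split// (le_trans (ler_normD _ _))// mulrDl; apply: lerD.
  exact: (cauchy_schwarz mO Lc (hessD_L2 w)).
apply: le_trans (cauchy_schwarz mO Lr (gradD_L2 w)) _.
by rewrite -mulrA ler_wpM2l ?norm2mx_ge0.
Qed.

(** [grad (E w)] is linear in [w] almost everywhere, by uniqueness of weak
derivatives, so [reconstruction_bounded] applies to the difference. *)
Lemma omegaD_bound (E : XD D -> 'rV[R]_d -> R) : companion E ->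
  0 <= omegaD E /\
  forall w, norm2mx Omega (fun x => gradD w x - grad Omega (E w) x) <=
    omegaD E * norm2mx Omega (hessD w).
Proof.
move=> [HE Elin].
have s1 w : sobolev Omega 1 (E w) by have [s2 _] := HE w; exact: sobolev_S.
have Lg w : L2mx Omega (grad Omega (E w)) by exact: L2mx_grad.
have glin : ae_linear Omega (fun w => grad Omega (E w)).
  move=> c v w.
  have wlin i : ae_eq mu Omega (weak_partial Omega i (E (c *: v + w)))
      (fun x => c * weak_partial Omega i (E v) x + weak_partial Omega i (E w) x).
    apply: ae_eq_trans (weak_partial_lin oO bO i c (s1 v) (s1 w)).
    rewrite (weak_partial_ae_ext oO bO i (sobolev_L2 (s1 _)) _ (Elin c v w)).
      exact: ae_eq_refl.
    exact: (L2_lin mO c (sobolev_L2 (s1 v)) (sobolev_L2 (s1 w))).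
  (* The exceptional sets of the coordinates are gathered as in [hess_test]. *)
  have : \forall x \ae mu, forall k, if unpickle k is Some i then
      Omega x -> weak_partial Omega (i : 'I_d) (E (c *: v + w)) x =
        c * weak_partial Omega i (E v) x + weak_partial Omega i (E w) x else True.
    apply: ae_foralln => k; case: (unpickle k) => [i|]; last exact: aeW.
    exact: wlin.
  apply: filterS => x Hx Ox; apply/rowP => i; rewrite !mxE.
  by have := Hx (pickle i); rewrite pickleK /=; exact.
pose L w x := gradD w x - grad Omega (E w) x.
have LL2 w : L2mx Omega (L w) := L2mxB mO (gradD_L2 w) (Lg w).
have Llin : ae_linear Omega L.
  move=> c v w; have := glin c v w; have := @gradD_linear _ _ _ D c v w.
  apply: filterS2 => x e1 e2 Ox; rewrite /L e1// e2// scalerBr opprD.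
  by rewrite addrACA.
have [K hK] := reconstruction_bounded LL2 Llin.
by apply: (sup_quotient (hessD_norm D) _ hK) => w; exact: norm2mx_ge0.
Qed.

Section scheme.
Variables (f u : 'rV[R]_d -> R) (uD : XD D).
Hypotheses (Lf : L2 Omega f) (Hu : H20 Omega u).
Hypothesis eq_u : forall v : 'rV[R]_d -> R, H20 Omega v ->
  aform Omega B u v = ip Omega f v.
Hypothesis eq_uD : forall vD : XD D, aformD uD vD = ip Omega f (PiD vD).

Let su : sobolev Omega 2 u. Proof. by case: Hu. Qed.
Let LHu : L2mx Omega (hessB Omega B u).
Proof. exact/L2mx_tapp/(L2mx_hess oO bO su). Qed.
Let LHd (w : XD D) : L2mx Omega (hessD w) := hessD_L2 w.

(** By [hessdiv_source] the first term of [calWD] is the pairing of [f] with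
[PiD w], which the scheme turns into a discrete energy. *)
Lemma calWD_residual w : calWD B (hess Omega u) w =
  ipmx Omega (fun x => hessD uD x - hessB Omega B u x) (hessD w).
Proof.
have [Lh hf] := hessdiv_source oO bO Lf su eq_u.
have Lp := PiD_L2 w.
rewrite /calWD RintegralB//; last 2 first.
- exact: (L2_integrableM mO Lh Lp).
- exact: (L2mx_ddot_integrable mO LHu (LHd w)).
rewrite (ipmxBl mO (LHd uD) LHu (LHd w)); congr (_ - _).
by apply: (etrans (ae_eq_ip mO Lh Lf Lp hf)); rewrite -eq_uD.
Qed.

Lemma WD_bound : 0 <= WD B D (hess Omega u) /\
  forall w, `|calWD B (hess Omega u) w| <=
    WD B D (hess Omega u) * norm2mx Omega (hessD w).
Proof.
apply: (@sup_quotient _ _ _ (fun w => `|calWD B (hess Omega u) w|)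
  (norm2mx Omega (fun x => hessD uD x - hessB Omega B u x)) (hessD_norm D)) => // w.
rewrite calWD_residual; exact: (cauchy_schwarz mO (L2mxB mO (LHd uD) LHu) (LHd w)).
Qed.

(** The argument of the second Strang lemma: the squared discrete norm of [uD - w]
splits into the defect of conformity and the interpolation error at [w]. *)
Lemma hessian_error_interpolation w :
  norm2mx Omega (fun x => hessD uD x - hessB Omega B u x) <=
  WD B D (hess Omega u) +
    2 * norm2mx Omega (fun x => hessD w x - hessB Omega B u x).
Proof.
set a := norm2mx _ (fun x => hessD w x - _).
have [W0 hW] := WD_bound.
have LB := L2mxB mO (LHd w) LHu; have LBu := L2mxB mO (LHd uD) LHu.
suff Nle : norm2mx Omega (hessD (uD - w)) <= WD B D (hess Omega u) + a.
  apply: le_trans (norm2mx_dist3 mO (LHd uD) LHu (LHd w)) _.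
  have e := ae_linearB (@hessD_linear _ _ _ D) uD w.
  rewrite -(ae_eq_norm2mx mO (LHd _) (L2mxB mO (LHd uD) (LHd w)) e).
  by rewrite -/a mulr2n mulrDl mul1r addrA lerD2r.
set N := norm2mx _ _; have N0 : 0 <= N by exact: norm2mx_ge0.
have NE : N ^+ 2 = calWD B (hess Omega u) (uD - w) -
    ipmx Omega (fun x => hessD w x - hessB Omega B u x) (hessD (uD - w)).
  rewrite sqr_norm2mx calWD_residual -(ipmxBl mO LBu LB (LHd _)).
  rewrite (_ : (fun x => _ - (hessD w x - _)) = fun x => hessD uD x - hessD w x).
    apply: (ae_eq_ipmx mO (LHd _) (L2mxB mO (LHd uD) (LHd w)) (LHd _) (LHd _) _
        (ae_eq_refl _ _ _)).
    exact: ae_linearB (@hessD_linear _ _ _ D) uD w.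
  by apply/funext => x; rewrite opprB addrA subrK.
have h1 := hW (uD - w).
have h2 := cauchy_schwarz mO LB (LHd (uD - w)).
rewrite -/N in h1 h2; rewrite -/a in h2.
have [->|Nn0] := eqVneq N 0; first by rewrite addr_ge0// norm2mx_ge0.
have Npos : 0 < N by rewrite lt_def Nn0.
rewrite -(ler_pM2r Npos) -expr2 NE mulrDl.
apply: le_trans (ler_norm _) _; apply: le_trans (ler_normB _ _) _.
exact: lerD.
Qed.

Lemma SD_ge0 : 0 <= SD B D u.
Proof.
apply: lb_le_inf; first by eexists; exists 0.
by move=> _ [w ->]; rewrite !addr_ge0// ?norm2_ge0// norm2mx_ge0.
Qed.

(** The infimum over [w] of [hessian_error_interpolation]. *)
Lemma hessian_error :
  norm2mx Omega (fun x => hessD uD x - hessB Omega B u x) <= 2 * WSD B D u.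
Proof.
have [W0 _] := WD_bound; have S0 := SD_ge0.
set A := norm2mx _ _.
suff : (A - WD B D (hess Omega u)) / 2 <= SD B D u by rewrite /WSD; lra.
apply: lb_le_inf; first by eexists; exists 0.
move=> _ [w ->]; have := hessian_error_interpolation w; rewrite -/A.
set a := norm2 _ _; set b := norm2mx _ _; set c := norm2mx _ _.
have a0 : 0 <= a by exact: norm2_ge0.
have b0 : 0 <= b by exact: norm2mx_ge0.
have c0 : 0 <= c by exact: norm2mx_ge0.
lra.
Qed.

End scheme.
End discretisation.

(** * The duality argument *)

(** [G] is the consistency error of the companion operator, [gE] the norm of the
gradient of the dual argument, [N] the discrete norm of [uD - P u]. *)
Lemma assemble_bounds (R : realFieldType) (lhs G gE G' N S a b o t w z K : R) :
  lhs <= G + gE + G' ->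
  gE <= K * G + t * N + 2 * S * a + w + z + K * G' ->
  N <= 2 * (S + b) -> 0 <= o -> 0 <= t -> 0 <= S -> 0 <= K ->
  0 <= z -> 0 <= w -> 0 <= G' -> 0 <= b -> 0 <= a -> G <= o * N ->
  lhs <= 2 * (1 + K) * ((o + t) * (S + b) + G' + z + S * a + w).
Proof.
move=> h1 h2 hN o0 t0 S0 K0 z0 w0 G0 b0 a0 hG.
have k1 : (1 + K) * G <= (1 + K) * (o * (2 * (S + b))).
  apply: ler_wpM2l; first by rewrite addr_ge0.
  by apply: le_trans hG _; exact: ler_wpM2l.
have k2 : t * N <= t * (2 * (S + b)) by exact: ler_wpM2l.
have k3 : 0 <= K * (t * (S + b)) by rewrite !mulr_ge0// addr_ge0.
have k4 : 0 <= K * (S * a) by rewrite !mulr_ge0.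
have k5 : 0 <= K * G' by exact: mulr_ge0.
have k6 : 0 <= K * z by exact: mulr_ge0.
have k7 : 0 <= K * w by exact: mulr_ge0.
lra.
Qed.

Section duality.
Context {R : realType} {d : nat}.
Variable Omega : set 'rV[R]_d.
Hypotheses (oO : open Omega) (bO : bounded_set Omega).
Variables (B : tensor4 R d) (phiq : 'rV[R]_d -> R).
Hypothesis s3 : sobolev Omega 3 phiq.
Notation flux := (fun y => tapp (ttr B) (tapp B (hess Omega phiq y))).
Notation g := (rowdiv Omega flux).

Let mO : measurable Omega. Proof. exact: open_measurable_rV. Qed.

Let Lg : L2mx Omega g.
Proof. by case: (rowdiv_spec oO bO B s3). Qed.

Let LHq : L2mx Omega (hessB Omega B phiq).
Proof. by apply: (L2mx_tapp oO); apply: (L2mx_hess oO bO s3). Qed.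

Lemma ipmx_hessB_H20 v : H20 Omega v ->
  ipmx Omega (hessB Omega B phiq) (hessB Omega B v) = - ipmx Omega g (grad Omega v).
Proof.
move=> Hv; have [_ wg _] := rowdiv_spec oO bO B s3.
rewrite -(green_rowdiv oO bO _ Lg wg Hv).
  by rewrite ipmxC /hessB ipmx_tapp ipmxC.
by do 2 apply: (L2mx_tapp oO); apply: (L2mx_hess oO bO s3).
Qed.

(** By [green_laplacian] the right-hand side of the dual problem, paired with [e],
is the norm of [grad e]; its left-hand side is then integrated by parts. *)
Lemma norm_grad_dual e : H20 Omega e -> norm2mx Omega (grad Omega e) != 0 ->
  (forall w, H20 Omega w -> aform Omega B w phiq =
     ip Omega (fun x => - laplacian Omega e x / norm2mx Omega (grad Omega e)) w) ->
  norm2mx Omega (grad Omega e) = - ipmx Omega g (grad Omega e).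
Proof.
move=> He; set n := norm2mx _ _ => n0 dual.
rewrite -ipmx_hessB_H20// ipmxC -[ipmx _ _ _]/(aform Omega B e phiq) dual//.
have [s2 _] := He; have Le := sobolev_L2 s2.
have Llap : L2 Omega (laplacian Omega e).
  rewrite (_ : laplacian Omega e = fun x => \sum_i hess Omega e x i i)//.
  by apply: (L2_sum mO) => i; exact: (L2mx_hess oO bO s2).
have -> : (fun x => - laplacian Omega e x / n) =
    fun x => - n^-1 * laplacian Omega e x + (fun=> 0) x.
  by apply/funext => x; rewrite addr0 mulrC mulrN mulNr.
rewrite (ip_lin mO _ Llap (L2_cst0 mO) Le) ip0l// addr0 green_laplacian//.
by rewrite -sqr_norm2mx -/n mulrNN expr2 mulrA mulVf// mul1r.
Qed.

Section identity.
Variables (f u : 'rV[R]_d -> R) (D : hessian_disc Omega) (uD : XD D).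
Hypotheses (Lf : L2 Omega f) (Hu : H20 Omega u).
Hypothesis eq_u : forall v : 'rV[R]_d -> R, H20 Omega v ->
  aform Omega B u v = ip Omega f v.
Hypothesis eq_uD : forall vD : XD D, aformD uD vD = ip Omega f (PiD vD).
Variables (v w : XD D) (e : 'rV[R]_d -> R).
Hypothesis He : H20 Omega e.

Let Lgrad z : H20 Omega z -> L2mx Omega (grad Omega z).
Proof. by move=> [s2 _]; exact: (L2mx_grad oO bO (sobolev_S s2)). Qed.

(** Here [v] plays the interpolant of [u] and [w] that of [phiq]. The discrete
Hessian of [uD - v], paired with that of [phiq], is expanded through the two
equations, which leave the defects of conformity at [w] and at [v]. *)
Lemma duality_identity :
  - ipmx Omega g (grad Omega e) =
    ipmx Omega g (fun x => gradD (uD - v) x - grad Omega e x)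
    - calWtD B (hess Omega phiq) (uD - v)
    + ipmx Omega (fun x => hessB Omega B phiq x - hessD w x)
        (fun x => hessD uD x - hessB Omega B u x)
    + calWD B (hess Omega u) w
    - calWtD B (hess Omega phiq) v
    + ipmx Omega g (fun x => gradD v x - grad Omega u x).
Proof.
have LHu : L2mx Omega (hessB Omega B u).
  by have [su _] := Hu; exact/(L2mx_tapp oO)/(L2mx_hess oO bO su).
have LHd (z : XD D) : L2mx Omega (hessD z) := hessD_L2 z.
have LGd (z : XD D) : L2mx Omega (gradD z) := gradD_L2 z.
have Lres := L2mxB mO (LHd uD) LHu.
rewrite (calWD_residual oO bO Lf Hu eq_u eq_uD).
have WtE (z : XD D) : calWtD B (hess Omega phiq) z =
    ipmx Omega (hessB Omega B phiq) (hessD z) + ipmx Omega g (gradD z).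
  exact: (@calWtD_split R d Omega oO D B (hess Omega phiq) z LHq Lg).
rewrite (WtE (uD - v)) (WtE v).
rewrite (ipmxBr mO (LGd (uD - v)) (Lgrad He) Lg).
rewrite (ipmxBr mO (LGd v) (Lgrad Hu) Lg).
rewrite (ipmxBl mO LHq (LHd w) Lres).
rewrite (ipmxBr mO (LHd uD) LHu LHq).
rewrite (ipmxC Omega (fun x => hessD uD x - hessB Omega B u x) (hessD w)).
rewrite (ipmx_hessB_H20 Hu).
rewrite (ipmx_linearB oO (@hessD_L2 _ _ _ D) (@hessD_linear _ _ _ D) uD v LHq).
generalize (ipmx Omega g (grad Omega e)) (ipmx Omega g (gradD (uD - v)))
  (ipmx Omega (hessB Omega B phiq) (hessD uD))
  (ipmx Omega (hessB Omega B phiq) (hessD v)) (ipmx Omega g (grad Omega u))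
  (ipmx Omega g (gradD v)).
by intros; ring.
Qed.

Lemma duality_bound (K : R) :
  norm2mx Omega g <= K ->
  - ipmx Omega g (grad Omega e) <=
    K * norm2mx Omega (fun x => gradD (uD - v) x - grad Omega e x)
    + WtD B D (hess Omega phiq) * norm2mx Omega (hessD (uD - v))
    + 2 * WSD B D u *
        norm2mx Omega (fun x => hessB Omega B phiq x - hessD w x)
    + `|calWD B (hess Omega u) w|
    + `|calWtD B (hess Omega phiq) v|
    + K * norm2mx Omega (fun x => grad Omega u x - gradD v x).
Proof.
move=> gK; rewrite duality_identity.
have LHu : L2mx Omega (hessB Omega B u).
  by have [su _] := Hu; exact/(L2mx_tapp oO)/(L2mx_hess oO bO su).
have LHd (z : XD D) : L2mx Omega (hessD z) := hessD_L2 z.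
have LGd (z : XD D) : L2mx Omega (gradD z) := gradD_L2 z.
have pair (z : 'rV[R]_d -> 'rV[R]_d) : L2mx Omega z -> ipmx Omega g z <= K *
    norm2mx Omega z.
  move=> Lz; apply: le_trans (ler_norm _) _.
  apply: le_trans (cauchy_schwarz mO Lg Lz) _.
  by rewrite ler_wpM2r// norm2mx_ge0.
have [_ hWt] := WtD_bound oO D (chi := hess Omega phiq) LHq Lg.
apply: lerD; [apply: lerD; [apply: lerD; [apply: lerD; [apply: lerD|]|]|]|].
- by apply: pair; exact: (L2mxB mO (LGd (uD - v)) (Lgrad He)).
- by apply: le_trans (hWt (uD - v)); rewrite -normrN ler_norm.
- apply: le_trans (ler_norm _) _.
  apply: le_trans (cauchy_schwarz mO (L2mxB mO LHq (LHd w)) (L2mxB mO (LHd uD)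
      LHu)) _.
  rewrite mulrC; apply: ler_wpM2r; first exact: norm2mx_ge0.
  exact: (hessian_error oO bO Lf Hu eq_u eq_uD).
- exact: ler_norm.
- by rewrite -normrN ler_norm.
- rewrite (norm2mxBC Omega (grad Omega u) (gradD v)).
  by apply: pair; exact: (L2mxB mO (LGd v) (Lgrad Hu)).
Qed.

End identity.
End duality.

Unset Implicit Arguments.
Set Strict Implicit.
Set Printing Implicit Defensive.

Theorem theorem3p7 (R : realType) (d : nat) (d_gt0 : (0 < d)%N)
    (Omega : set 'rV[R]_d)
    (Omega_domain : is_domain Omega) (Omega_bounded : bounded_set Omega)
    (A : 'rV[R]_d -> tensor4 R d) (B : tensor4 R d)
    (A_coeff : coeff_tensor Omega A) (AB : factorizes Omega A B)
    (B_coercive : coercive Omega B)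
    (CDmax Creg : R) :
  exists C : R,
    forall (f u : 'rV[R]_d -> R) (D : hessian_disc Omega) (uD : XD D)
      (E : XD D -> 'rV[R]_d -> R) (P : ('rV[R]_d -> R) -> XD D)
      (phiq : 'rV[R]_d -> R),
    L2 Omega f ->
    H20 Omega u ->
    (forall v, H20 Omega v -> aform Omega B u v = ip Omega f v) ->
    (forall vD : XD D, aformD uD vD = ip Omega f (PiD vD)) ->
    companion E ->
    H20_map P ->
    let e := E (uD - P u) in
    let q := fun x => - laplacian Omega e x / norm2mx Omega (grad Omega e) in
    H20 Omega phiq ->
    (forall w, H20 Omega w -> aform Omega B w phiq = ip Omega q w) ->
    sobolev Omega 3 phiq ->
    sobolev_norm Omega 3 phiq <= Creg ->
    CD D <= CDmax ->
    norm2mx Omega (fun x => gradD uD x - grad Omega u x) <=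
    C * ((omegaD E + WtD B D (hess Omega phiq)) *
           (WSD B D u +
            norm2mx Omega (fun x => hessB Omega B u x - hessD (P u) x)) +
         norm2mx Omega (fun x => grad Omega u x - gradD (P u) x) +
         `|calWtD B (hess Omega phiq) (P u)| +
         WSD B D u *
           norm2mx Omega (fun x => hessB Omega B phiq x - hessD (P phiq) x) +
         `|calWD B (hess Omega u) (P phiq)|).
Proof.
have [oO _ _] := Omega_domain.
have mO : measurable Omega := open_measurable_rV oO.
pose MB := \sum_i \sum_j \sum_(p : 'I_d * 'I_d) `|tcomp (ttr B) B i j p.1 p.2|.
have MB0 : 0 <= MB.
  by apply: sumr_ge0 => i _; apply: sumr_ge0 => j _; exact: sumr_ge0.
(* [K] bounds the row divergence of the flux of [phiq]; taking a maximum keeps it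
   nonnegative for every [Creg]. *)
pose K := MB * Num.max Creg 0.
have K0 : 0 <= K by rewrite mulr_ge0// le_max lexx orbT.
(* The factor 2 is that of [hessian_error]; the consistency error of [E] enters
   once directly, and once multiplied by [K] through the norm of [grad e]. *)
exists (2 * (1 + K)).
move=> f u D uD E P phiq Lf Hu eq_u eq_uD cE _ e q Hq dual s3 regq _.
have [LHq' _ gnorm] := rowdiv_spec oO Omega_bounded B s3.
have gK : norm2mx Omega (rowdiv Omega (fun y => tapp (ttr B) (tapp B (hess
    Omega phiq y)))) <= K.
  by apply: le_trans gnorm _; rewrite ler_wpM2l// le_max regq.
have He : H20 Omega e by have [HE _] := cE; exact: (HE (uD - P u)).
have LHu : L2mx Omega (hessB Omega B u).
  by have [su _] := Hu; exact/(L2mx_tapp oO)/(L2mx_hess oO Omega_bounded su).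
have LHq : L2mx Omega (hessB Omega B phiq).
  by apply: (L2mx_tapp oO); apply: (L2mx_hess oO Omega_bounded s3).
have Lgrad z : H20 Omega z -> L2mx Omega (grad Omega z).
  by move=> [s2 _]; exact: (L2mx_grad oO Omega_bounded (sobolev_S s2)).
have LHd (z : XD D) : L2mx Omega (hessD z) := hessD_L2 z.
have LGd (z : XD D) : L2mx Omega (gradD z) := gradD_L2 z.
have [om0 hom] := omegaD_bound oO Omega_bounded cE.
have [Wt0 _] := WtD_bound oO D (chi := hess Omega phiq) LHq LHq'.
have [WD0 _] := WD_bound oO Omega_bounded Lf Hu eq_u eq_uD.
have SD0 := SD_ge0 D B u.
have WS0 : 0 <= WSD B D u by rewrite addr_ge0.
have herr := hessian_error oO Omega_bounded Lf Hu eq_u eq_uD.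
have hpsi : norm2mx Omega (hessD (uD - P u)) <=
    2 * (WSD B D u + norm2mx Omega (fun x => hessB Omega B u x - hessD (P u) x)).
  have ae := ae_linearB (@hessD_linear _ _ _ D) uD (P u).
  rewrite (ae_eq_norm2mx mO (LHd _) (L2mxB mO (LHd uD) (LHd (P u))) ae).
  apply: le_trans (norm2mx_dist3 mO (LHd uD) (LHd (P u)) LHu) _.
  rewrite mulrDr; apply: lerD => //.
  by rewrite mulr2n mulrDl mul1r lerDl norm2mx_ge0.
have hgrad : norm2mx Omega (fun x => gradD uD x - grad Omega u x) <=
    norm2mx Omega (fun x => gradD (uD - P u) x - grad Omega e x) +
    norm2mx Omega (grad Omega e) +
    norm2mx Omega (fun x => grad Omega u x - gradD (P u) x).
  apply: le_trans (norm2mx_dist3 mO (LGd uD) (Lgrad u Hu) (LGd (P u))) _.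
  rewrite [X in _ + X]norm2mxBC lerD2r.
  have ae := ae_linearB (@gradD_linear _ _ _ D) uD (P u).
  rewrite -(ae_eq_norm2mx mO (LGd _) (L2mxB mO (LGd uD) (LGd (P u))) ae).
  have := norm2mx_lin mO 1 (L2mxB mO (LGd (uD - P u)) (Lgrad e He)) (Lgrad e He).
  rewrite normr1 mul1r; congr (_ <= _); congr norm2mx.
  by apply/funext => x; rewrite scale1r subrK.
have hE : norm2mx Omega (grad Omega e) <=
    K * norm2mx Omega (fun x => gradD (uD - P u) x - grad Omega e x)
    + WtD B D (hess Omega phiq) * norm2mx Omega (hessD (uD - P u))
    + 2 * WSD B D u *
        norm2mx Omega (fun x => hessB Omega B phiq x - hessD (P phiq) x)
    + `|calWD B (hess Omega u) (P phiq)|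
    + `|calWtD B (hess Omega phiq) (P u)|
    + K * norm2mx Omega (fun x => grad Omega u x - gradD (P u) x).
  (* When [grad e] vanishes, [q] is a quotient by 0, but nothing is to be bounded. *)
  have [->|n0] := eqVneq (norm2mx Omega (grad Omega e)) 0.
    by do ![exact: norm2mx_ge0|exact: normr_ge0|exact: WS0|exact: K0|exact: Wt0
      |exact: ler0n|apply: addr_ge0|apply: mulr_ge0].
  rewrite (norm_grad_dual oO Omega_bounded s3 He n0 dual).
  exact: (duality_bound oO Omega_bounded s3 Lf Hu eq_u eq_uD (P u) (P phiq) He gK).
by apply: (assemble_bounds hgrad hE hpsi om0 Wt0 WS0 K0 _ _ _ _ _ (hom (uD - P u)));
  exact: norm2mx_ge0 || exact: normr_ge0.
Qed.
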